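(* Let $n\geq 2$ be an integer and let $P\colon\mathbb{C}^n\to\mathbb{R}$ be a homogeneous, plurisubharmonic, non-pluriharmonic polynomial. Then there are at most finitely many complex hyperplanes through the origin in $\mathbb{C}^n$ along which $P$ is pluriharmonic.
   Context: A polynomial $P\colon\mathbb{C}^n\to\mathbb{R}$ means a real-valued polynomial in $z_1,\dots,z_n,\overline{z_1},\dots,\overline{z_n}$; homogeneous means $\mathbb{R}$-homogeneous, i.e. every monomial $z^\alpha\overline{z}^\beta$ appearing in $P$ has the same total degree $|\alpha|+|\beta|$. A complex hyperplane through the origin is a complex linear subspace of dimension $n-1$. $P$ is pluriharmonic along a hyperplane $H$ if the restriction $P|_H$ is a pluriharmonic function on the complex vector space $H$ (harmonic, if $\dim_{\mathbb{C}} H=1$). *)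

(* Defs.v *)
From HB Require Import structures.
From mathcomp Require Import all_boot all_order all_algebra.
From mathcomp Require Import complex.
From mathcomp Require Import all_classical all_reals all_analysis.
(* The notations of mpoly clash with those of the analysis library. *)
From mathcomp.multinomials Require mpoly.
Import (canonicals) mpoly.

Set Implicit Arguments.
Unset Strict Implicit.
Unset Printing Implicit Defensive.

Import Order.TTheory GRing.Theory Num.Theory.
Import numFieldNormedType.Exports.

Local Open Scope classical_set_scope.
Local Open Scope ring_scope.
Local Open Scope complex_scope.

(* R[i] carries no topology in the library: give it the one of its modulus, *)
(* so that 'rV[R[i]]_n gets the usual topology of C^n.                      *)
HB.instance Definition _ (R : realType) := GRing.ComAlgebra.copy R[i] (R[i]^o).
HB.instance Definition _ (R : realType) := Vector.copy R[i] (R[i]^o).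
HB.instance Definition _ (R : realType) := NormedModule.copy R[i] (R[i]^o).

(* A real-valued polynomial in z_1, .., z_n, conj z_1, .., conj z_n, all of   *)
(* whose monomials have the same total degree: the first n indeterminates of *)
(* p stand for the z_j, the last n ones for their conjugates.                *)
Definition homogeneous_polynomial (R : realType) (n : nat)
    (P : 'rV[R[i]]_n -> R) : Prop :=
  exists (d : nat) (p : mpoly.mpoly (n + n) R[i]),
    {in mpoly.msupp p, forall m, mpoly.mdeg m = d} /\
    forall z : 'rV[R[i]]_n,
      (P z)%:C = mpoly.meval (row_mx z (map_mx (@conjc R) z) 0) p.

Section Functions.
Context {R : realType} {V : normedModType R[i]}.
Implicit Types (A : set V) (u : V -> R).

Definition upper_semicontinuous u : Prop :=
  lower_semicontinuous (fun x => (- u x)%:E).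

(* Directional derivatives along real lines. *)
Definition dderivable u (v x : V) : Prop :=
  derivable (fun t : R => u (x + t%:C *: v)) 0 1.

Definition dderive u (v x : V) : R :=
  derive1 (fun t : R => u (x + t%:C *: v)) 0.

(* u restricted to the linear subspace A is of class C^2. As the lines        *)
(* involved stay in A, this only depends on the values of u on A.             *)
Definition C2_along A u : Prop :=
  forall v w, A v -> A w ->
    (forall x, A x -> dderivable u v x /\ dderivable (dderive u v) w x) /\
    {within A, continuous (dderive (dderive u v) w)}.

End Functions.

(* The sub-mean value inequality on every circle. The integral is taken in    *)
(* \bar R, since it may be -oo for a general upper semicontinuous u.           *)
Definition subharmonic (R : realType) (u : R[i] -> R) : Prop :=
  upper_semicontinuous u /\
  forall (c : R[i]) (r : R), 0 < r ->
    ((2 * pi * u c)%R%:E <=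
     \int[@lebesgue_measure R]_(t in `[0%R, (2 * pi)%R])
       (u (c + r%:C * (cos t +i* sin t))%C)%:E)%E.

Definition harmonic_function (R : realType) (u : R[i] -> R) : Prop :=
  C2_along setT u /\
  forall z, dderive (dderive u 1) 1 z + dderive (dderive u 'i) 'i z = 0.

Definition plurisubharmonic (R : realType) (n : nat)
    (u : 'rV[R[i]]_n -> R) : Prop :=
  upper_semicontinuous u /\
  forall a b : 'rV[R[i]]_n, subharmonic (fun z : R[i] => u (a + z *: b)).

(* The restriction of u to H is of class C^2 and is harmonic on every complex *)
(* line of H.                                                                 *)
Definition pluriharmonic_along (R : realType) (n : nat)
    (H : {vspace 'rV[R[i]]_n}) (u : 'rV[R[i]]_n -> R) : Prop :=
  C2_along [set x | x \in H] u /\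
  forall a b : 'rV[R[i]]_n, a \in H -> b \in H ->
    harmonic_function (fun z : R[i] => u (a + z *: b)).

Definition pluriharmonic (R : realType) (n : nat)
    (u : 'rV[R[i]]_n -> R) : Prop :=
  pluriharmonic_along fullv u.

(* Main.v *)
Require Import Defs.
From mathcomp Require Import all_boot all_order all_algebra.
From mathcomp Require Import complex polyrcf polyXY.
From mathcomp Require Import all_classical all_reals all_analysis.
From mathcomp Require Import ring lra zify.
From mathcomp.multinomials Require mpoly.

(** Write [P] as the real part of a sum of terms [c z^alpha (conj z)^beta], all
of the same total degree [d], and let [A], the balanced part, be the sum of
those with [|alpha| = |beta| > 0]; for these, [|alpha| = d/2].

A plurisubharmonic polynomial has a nonnegative Levi form: on the complex line
[x + w b], the sub-mean value inequality on small circles says that the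
coefficient of [w (conj w)] is nonnegative ([subharmonic_coef11_ge0],
[levi_ge0]). Averaging the Levi form of [P] over the rotations [e^(it) z] gives
that of [A], which is therefore nonnegative too ([balanced_levi_ge0]).

If [P] is harmonic on the complex line through 0 and [x], then averaging its
Laplacian over the unit circle gives [A x = 0] ([harmonic_balanced_part]).
Conversely, if [A x = 0] then the Laplacian of [P] along that line is a
nonnegative trigonometric polynomial with zero mean on the unit circle, hence
vanishes, and the terms with [alpha] and [beta] both nonzero cancel at [x]
([mixed_sum_eq0]). If [A] were zero, [P] would thus be the real part of a sum of
holomorphic and antiholomorphic polynomials, hence pluriharmonic
([balanced_part_eq0_pluriharmonic]). So there is [v] with [A v != 0], and every
hyperplane [H] of the theorem avoids [v] and lies in the zero set of [A].

The heart of the proof is that [F w = A (u + w v)] has finitely many zeros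
([finite_balanced_zeros]). As [A] is homogeneous, Euler's identity turns the
Levi form of [A] at [z = u + w v] in the directions [xi z + v] into a quadratic
polynomial in [xi]; its discriminant gives [|grad F|^2 <= F Delta F], i.e.
[ln F] is subharmonic ([balanced_line_log_laplacian]). A nonzero real polynomial
[F] in two variables with this property has a finite zero set
([finite_set_log_laplacian]). Otherwise, choose [g] of least degree in the first
variable among the nonzero polynomials that vanish at infinitely many zeros of
[F]. By pseudo-division, [c F = g^m h] where [c], in the second variable only,
[h] and the derivative [g'] vanish at finitely many of these zeros. At one of
the others, the multiplicativity of [F Delta F - |grad F|^2] makes this
expression negative nearby ([log_laplacian_singular]), because [g' != 0] there.

Finally, for each unit vector [e_i] there is [w_i] with [e_i + w_i v] in [H];
there [A] vanishes, so [w_i] ranges over a finite set, and [H] is determined by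
the [w_i] ([finite_hyperplanes]). *)

Set Implicit Arguments.
Unset Strict Implicit.
Unset Printing Implicit Defensive.

Import Order.TTheory GRing.Theory Num.Theory.
Import numFieldNormedType.Exports.

Local Open Scope classical_set_scope.
Local Open Scope ring_scope.
Local Open Scope complex_scope.

(* The real and imaginary parts with values in the real field. *)
Local Notation Re := (@complex.Re _).
Local Notation Im := (@complex.Im _).

(** * Roots of univariate polynomials *)

Section UnivariateRoots.
Variable R : rcfType.
Implicit Types p q : {poly R}.

Lemma finite_set_root p : p != 0 -> finite_set [set x | p.[x] = 0].
Proof.
move=> p0; apply: contrapT => /(@infinite_set_fset _ _ (size p))[B Bp].
apply/negP; rewrite -ltnNge; apply: max_poly_roots => //; last first.
  exact: finmap.fset_uniq.
by apply/allP => x xB; apply/rootP; exact: Bp.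
Qed.

(** The non-roots of a nonzero polynomial are dense. *)
Lemma horner_ge0_dense p q : q != 0 ->
  (forall x, q.[x] != 0 -> 0 <= p.[x]) -> forall x, 0 <= p.[x].
Proof.
move=> q0 pge0 x; rewrite leNgt; apply/negP => px0.
have [d d0 dP] := @poly_cont R x p (- p.[x]) ltac:(by rewrite oppr_gt0).
pose t (i : nat) := x + d / i.+2%:R.
have tinj : injective t.
  move=> i j /addrI/(mulfI (lt0r_neq0 d0))/invr_inj/eqP.
  by rewrite eqr_nat => /eqP[->].
have troot i : root q (t i).
  apply: contraT => /pge0 ge0; have := dP (t i).
  rewrite /t addrC addKr gtr0_norm ?divr_gt0// ltr_pdivrMr// ltr_pMr// ltr1n.
  move=> /(_ isT); rewrite ltNge (le_trans _ (ler_norm _))//.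
  by rewrite lerDr.
have := @max_poly_roots _ q (map t (iota 0 (size q))) q0.
rewrite size_map size_iota ltnn map_inj_uniq// iota_uniq => max_roots.
suff: false by []; apply: max_roots => //; apply/allP => _ /mapP[i _ ->];
exact: troot.
Qed.

End UnivariateRoots.

(** * Zero sets of bivariate polynomials *)

Section Bivariate.
Variable R : comNzRingType.
Implicit Types u v : {poly {poly R}}.

(** The derivative of a bivariate polynomial in its inner variable; the
derivative in the outer one is [deriv]. *)
Definition derivY u : {poly {poly R}} := swapXY (swapXY u)^`().

Lemma coef_derivY u i : (derivY u)`_i = (u`_i)^`().
Proof.
apply/polyP => j.
by rewrite coef_swapXY !coef_deriv coefMn coef_swapXY.
Qed.

Lemma derivYD u v : derivY (u + v) = derivY u + derivY v.
Proof. by rewrite /derivY rmorphD derivD rmorphD. Qed.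

Lemma derivYM u v : derivY (u * v) = derivY u * v + u * derivY v.
Proof. by rewrite /derivY rmorphM derivM rmorphD !rmorphM /= !swapXYK. Qed.

(** The polynomial [u Delta u - |grad u|^2]: the Laplacian of [ln u] is its
quotient by [u^2]. *)
Definition log_laplacian u :=
  u * (u^`()^`() + derivY (derivY u)) - (u^`() ^+ 2 + derivY u ^+ 2).

Lemma log_laplacianM u v : log_laplacian (u * v) =
  u ^+ 2 * log_laplacian v + v ^+ 2 * log_laplacian u.
Proof.
rewrite /log_laplacian !(derivM, derivYM, derivD, derivYD); ring.
Qed.

Lemma log_laplacianX u n :
  log_laplacian (u ^+ n.+1) = n.+1%:R * (u ^+ n) ^+ 2 * log_laplacian u.
Proof.
elim: n => [|n IHn]; first by rewrite expr0 expr1n mulr1 mul1r expr1.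
rewrite exprS log_laplacianM IHn !(exprS u n) -[in RHS]natr1; ring.
Qed.

Lemma log_laplacian_swapXY u :
  log_laplacian (swapXY u) = swapXY (log_laplacian u).
Proof.
have dX v : (swapXY v)^`() = swapXY (derivY v) by rewrite /derivY swapXYK.
have dY v : derivY (swapXY v) = swapXY v^`() by rewrite /derivY swapXYK.
rewrite /log_laplacian (dX u) (dY u) (dX (derivY u)) (dY u^`()).
have morphE (f : {rmorphism {poly {poly R}} -> {poly {poly R}}}) a b c d e :
    f (a * (b + c) - (d ^+ 2 + e ^+ 2)) =
    f a * (f b + f c) - (f d ^+ 2 + f e ^+ 2).
  by rewrite rmorphB rmorphM !rmorphD !rmorphXn.
by rewrite (morphE swapXY); congr (_ * _ - _); rewrite addrC.
Qed.

(** The case [u = g^(m + 1) h / c], with denominators cleared. *)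
Lemma log_laplacian_factor u (c g h : {poly {poly R}}) m :
  c * u = g ^+ m.+1 * h ->
  c ^+ 4 * log_laplacian u = (g ^+ m) ^+ 2 *
    (c ^+ 2 * (g ^+ 2 * log_laplacian h + m.+1%:R * h ^+ 2 * log_laplacian g)
     - g ^+ 2 * h ^+ 2 * log_laplacian c).
Proof.
move=> cu; have := congr1 log_laplacian cu.
rewrite !log_laplacianM log_laplacianX.
move: (log_laplacian u) (log_laplacian c) (log_laplacian g) (log_laplacian h).
move: (g ^+ m) (exprS g m) => k gS Lu Lc Lg Lh E.
transitivity (c ^+ 2 * (c ^+ 2 * Lu + u ^+ 2 * Lc) - (c * u) ^+ 2 * Lc).
  by ring.
by rewrite E cu gS; ring.
Qed.

End Bivariate.

Section ZeroSet.
Variable R : rcfType.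
Implicit Types (u c g h : {poly {poly R}}) (x y : R).

(** With [c] and [h] nonzero at [(x, y)], the right-hand side of
[log_laplacian_factor] would be negative at the points of the line parallel to
the first axis that are close to [(x, y)] and distinct from it. *)
Lemma log_laplacian_singular u c g h m x y :
  (forall x y, 0 <= (log_laplacian u).[x, y]) ->
  c * u = g ^+ m.+1 * h -> g.[x, y] = 0 -> g^`().[x, y] != 0 ->
  c.[x, y] * h.[x, y] = 0.
Proof.
move=> u_ge0 /log_laplacian_factor; set E := (_ - _) => cuE gxy dgxy.
have evE v t : (map_poly (horner_eval y) v).[t] = v.[t, y].
  by have := horner_map (horner_eval y) v t%:P; rewrite /= /horner_eval hornerC.
have evM a b x1 y1 : (a * b).[x1, y1] = a.[x1, y1] * b.[x1, y1].
  by rewrite !hornerM.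
have evX a n x1 y1 : (a ^+ n).[x1, y1] = a.[x1, y1] ^+ n by rewrite !horner_exp.
have E_ge0 : 0 <= E.[x, y].
  rewrite -evE; apply: (@horner_ge0_dense _ _ (map_poly (horner_eval y) g)).
    apply: contra_neq dgxy => g0.
    by rewrite -evE -deriv_map g0 deriv0 horner0.
  move=> t; rewrite !evE => gt0.
  have := congr1 (fun v => v.[t, y]) cuE.
  rewrite evM [RHS]evM !evX => cE.
  rewrite -(pmulr_rge0 _ (_ : 0 < (g.[t, y] ^+ m) ^+ 2)) -?cE.
    by rewrite mulr_ge0// exprn_even_ge0.
  by rewrite exprn_even_gt0// expf_neq0.
have EE : E.[x, y] = - (m.+1%:R * (c.[x, y] * h.[x, y]) ^+ 2 *
                        (g^`().[x, y] ^+ 2 + (derivY g).[x, y] ^+ 2)).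
  rewrite /E /log_laplacian.
  rewrite !(hornerM, hornerD, hornerN, horner_exp, hornerMn, hornerC) gxy.
  ring.
apply/eqP; rewrite -sqrf_eq0 eq_le sqr_ge0 andbT.
move: E_ge0; rewrite EE oppr_ge0 pmulr_lle0; last first.
  by rewrite ltr_pwDl ?sqr_ge0// exprn_even_gt0.
by rewrite pmulr_rle0.
Qed.

(** The polynomial [u] does not vanish identically on a line parallel to the
second axis. *)
Lemma log_laplacian_horner_neq0 u x :
  (forall x y, 0 <= (log_laplacian u).[x, y]) -> u != 0 -> u.[x%:P] != 0.
Proof.
move=> u_ge0 u0; apply/negP => /eqP ux0.
have [m [h hx uE]] := multiplicity_XsubC u x%:P.
have {}hx : h.[x%:P] != 0 by have := hx; rewrite u0.
case: m uE => [|m] uE.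
  by move: hx; rewrite -ux0 uE expr0 mulr1 eqxx.
have [y hy] : exists y, h.[x, y] != 0.
  apply: contrapT => hxy; case/negP: hx; apply/eqP/(@polyP _ _ 0).
  have : finite_set [set y | h.[x%:P].[y] = 0] -> False.
    have -> : [set y | h.[x%:P].[y] = 0] = setT.
      apply/seteqP; split => // y _; apply/eqP/negPn/negP => hy.
      by apply: hxy; exists y.
    move=> /(finite_preimage (f := fun n : nat => n%:R : R)).
    rewrite preimage_setT => fin; apply: infinite_nat; apply: fin.
    by move=> i j _ _ /eqP; rewrite eqr_nat => /eqP.
  by move=> inf; case: (eqVneq h.[x%:P] 0) => [->//|/finite_set_root/inf].
have xE : 1 * u = ('X - x%:P%:P) ^+ m.+1 * h by rewrite mul1r uE mulrC.
move/eqP: hy; apply.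
have := log_laplacian_singular (x := x) (y := y) u_ge0 xE.
by rewrite derivXsubC !hornerE ?subrr ?mul1r ?oner_neq0; apply.
Qed.

Lemma finite_set_log_laplacian u :
  u != 0 -> (forall x y, 0 <= (log_laplacian u).[x, y]) ->
  finite_set [set z : R * R | u.[z.1, z.2] = 0].
Proof.
move=> u0 u_ge0; apply: contrapT => Uinf.
have finY (c : {poly R}) : c != 0 ->
    finite_set [set z : R * R | u.[z.1, z.2] = 0 /\ c.[z.2] = 0].
  move=> /finite_set_root cfin.
  pose L y := [set (x, y) | x in [set x | u.[x, y] = 0]].
  apply: (sub_finite_set (B := \bigcup_(y in [set y | c.[y] = 0]) L y)).
    by move=> [x y] /= [uxy cy]; exists y => //; exists x.
  apply: bigcup_finite => // y _; apply: finite_image.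
  rewrite (_ : [set x | _] = [set x | (swapXY u).[y%:P].[x] = 0]); last first.
    by apply/seteqP; split => x /=; rewrite horner2_swapXY.
  apply: finite_set_root; apply: log_laplacian_horner_neq0.
    by move=> x1 y1; rewrite log_laplacian_swapXY horner2_swapXY.
  by rewrite swapXY_eq0.
pose Z g := [set z : R * R | u.[z.1, z.2] = 0 /\ g.[z.1, z.2] = 0].
(* [g] has minimal degree in the first variable among the nonzero polynomials
   vanishing at infinitely many zeros of [u] *)
have exN : exists N : nat, `[< exists2 g : {poly {poly R}},
    g != 0 & size g = N /\ ~ finite_set (Z g) >].
  exists (size u); apply/asboolP; exists u => //; split => //.
  apply: contra_not Uinf; apply: sub_finite_set => z uz; exact: conj.
have [N /asboolP[g g0 [gN Ginf]] Nmin] := ex_minnP exN.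
pose Zg h := [set z | Z g z /\ h.[z.1, z.2] = 0].
have small (h : {poly {poly R}}) :
    (size h < size g)%N -> ~ finite_set (Zg h) -> h = 0.
  move=> hg hinf; apply/eqP/negPn/negP => h0.
  move: hg; rewrite gN ltnNge => /negP; apply; apply: Nmin; apply/asboolP.
  exists h => //; split => //; apply: contra_not hinf; apply: sub_finite_set.
  by move=> z [[]].
have g_gt1 : (1 < size g)%N.
  rewrite ltnNge; apply/negP => /size1_polyC gE; apply: Ginf.
  have := finY g`_0; rewrite -polyC_eq0 -gE => /(_ g0); apply: sub_finite_set.
  by move=> z []; rewrite gE hornerC coefC.
(* [m] is the multiplicity of [g] in [h] over the rational functions of the
   second variable *)
have factor (h : {poly {poly R}}) : h != 0 -> exists (c : {poly R}) (m : nat) k,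
    [/\ c != 0, c%:P * h = g ^+ m * k & finite_set (Zg k)].
  have [n] := ubnP (size h); elim: n h => // n IHn h hn h0.
  have [fin|inf] := pselect (finite_set (Zg h)).
    by exists 1, 0%N, h; split; rewrite ?oner_eq0// expr0 !mul1r.
  have /= hE := Pdiv.Idomain.divp_eq h g.
  have rem0 : h %% g = 0.
    apply: small; first by rewrite ltn_modpN0.
    apply: contra_not inf; apply: sub_finite_set => z [[uz gz] hz].
    split => //; have := congr1 (fun v => v.[z.1, z.2]) hE.
    by rewrite -mul_polyC !hornerE hz gz !mulr0 add0r.
  rewrite rem0 addr0 in hE.
  have lc0 : lead_coef g ^+ scalp h g != 0 by rewrite expf_neq0// lead_coef_eq0.
  have q0 : h %/ g != 0.
    apply: contra_neq h0 => q0; move: hE; rewrite q0 mul0r -mul_polyC => /eqP.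
    by rewrite mulf_eq0 polyC_eq0 (negPf lc0) => /eqP.
  have [|c [m [k [c0 qE fin]]]] := IHn (h %/ g) _ q0.
    apply: leq_trans (hn : (size h <= n)%N).
    rewrite -(size_scale h lc0) hE size_mul//.
    by case: (size g) g_gt1 => [|[|s]]// _; rewrite addnS/= addnS ltnS leq_addr.
  exists (c * lead_coef g ^+ scalp h g), m.+1, k; split => //.
    by rewrite mulf_neq0.
  rewrite polyCM -mulrA [_%:P * h]mul_polyC hE mulrA qE exprS; ring.
have [c [[|m] [k [c0 uE fin]]]] := factor u u0.
  apply: Ginf; apply: sub_finite_set fin => z [uz gz]; split => //.
  have := congr1 (fun v => v.[z.1, z.2]) uE.
  by rewrite expr0 mul1r !hornerE uz mulr0.
apply: Ginf; have gx0 : finite_set (Zg g^`()).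
  apply: contrapT => /small; rewrite lt_size_deriv// => /(_ isT)/polyP.
  move=> /(_ (size g).-2); rewrite coef_deriv coef0 => /eqP.
  have -> : (size g).-2.+1 = (size g).-1 by case: (size g) g_gt1 => [|[]].
  rewrite -mulr_natl mulf_eq0 -lead_coefE lead_coef_eq0 (negPf g0) orbF.
  by rewrite -polyC_natr polyC_eq0 pnatr_eq0; case: (size g) g_gt1 => [|[]].
have := finY c c0; set Zc := [set z | _] => cfin.
apply: (sub_finite_set (B := Zc `|` Zg k `|` Zg g^`())); last first.
  by rewrite !finite_setU.
move=> z [uz gz]; have [gz'|gz'] := eqVneq g^`().[z.1, z.2] 0.
  by right.
left; have /eqP := log_laplacian_singular u_ge0 uE gz gz'.
by rewrite hornerC mulf_eq0 => /orP[/eqP cz|/eqP kz]; [left|right].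
Qed.

End ZeroSet.

(** * Real parts of complex polynomials *)

Section RealParts.
Variable R : rcfType.
Local Notation C := R[i].
Implicit Types (e : C) (f g : {poly C}) (u v : {poly {poly C}}) (x y : R).

Lemma ReD (a b : C) : Re (a + b) = Re a + Re b.
Proof. by case: a b => ? ? []. Qed.

Lemma ReN (a : C) : Re (- a) = - Re a.
Proof. by case: a. Qed.

Lemma Re_sum (I : Type) (s : seq I) (Q : pred I) (a : I -> C) :
  Re (\sum_(k <- s | Q k) a k) = \sum_(k <- s | Q k) Re (a k).
Proof. exact: (big_morph Re ReD). Qed.

Lemma ReMr (a : C) x : Re (a * x%:C) = Re a * x.
Proof. by case: a => a b; rewrite /= mulr0 subr0. Qed.

Lemma ReMl (a : C) x : Re (x%:C * a) = x * Re a.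
Proof. by rewrite mulrC ReMr mulrC. Qed.

Lemma ReMn (a : C) n : Re (a *+ n) = Re a *+ n.
Proof. by elim: n => // n IH; rewrite !mulrS ReD IH. Qed.

(** The bivariate polynomial [f(x + e y)]. *)
Definition xey_poly e f : {poly {poly C}} :=
  (map_poly (polyC \o polyC) f).['X + e%:P%:P * 'Y].

Lemma xey_poly0 e : xey_poly e 0 = 0.
Proof. by rewrite /xey_poly rmorph0 horner0. Qed.

Lemma xey_polyMXaddC e f (a : C) : xey_poly e (f * 'X + a%:P) =
  xey_poly e f * ('X + e%:P%:P * 'Y) + a%:P%:P.
Proof.
by rewrite /xey_poly rmorphD rmorphM/= map_polyX map_polyC/= hornerMXaddC.
Qed.

Lemma xey_polyE e f x y :
  (xey_poly e f).[x%:C, y%:C] = f.[x%:C + e * y%:C].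
Proof.
elim/poly_ind: f => [|f c IHf]; first by rewrite xey_poly0 !horner0.
rewrite xey_polyMXaddC hornerMXaddC -{}IHf; move: (xey_poly e f) => u.
by rewrite !(hornerM, hornerD, hornerC, hornerX).
Qed.

Lemma xey_polyD e f g : xey_poly e (f + g) = xey_poly e f + xey_poly e g.
Proof. by rewrite /xey_poly rmorphD hornerD. Qed.

Lemma xey_polyMX e f :
  xey_poly e (f * 'X) = xey_poly e f * ('X + e%:P%:P * 'Y).
Proof. by have := xey_polyMXaddC e f 0; rewrite !addr0. Qed.

Lemma deriv_xey_poly e f : (xey_poly e f)^`() = xey_poly e f^`().
Proof.
elim/poly_ind: f => [|f c IHf]; first by rewrite deriv0 xey_poly0 deriv0.
rewrite derivD derivM derivX derivC mulr1 addr0.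
rewrite xey_polyMXaddC xey_polyD xey_polyMX -{}IHf.
move: (xey_poly e f) => u.
rewrite !(derivD, derivM, derivX, derivC); ring.
Qed.

Lemma derivYC (a : C) : derivY a%:P%:P = 0.
Proof. by rewrite /derivY swapXY_polyC map_polyC derivC rmorph0. Qed.

Lemma derivY_xey_poly e f :
  derivY (xey_poly e f) = e%:P%:P * xey_poly e f^`().
Proof.
elim/poly_ind: f => [|f c IHf].
  by rewrite deriv0 xey_poly0 mulr0 -[0]/(0%:P%:P) derivYC.
rewrite derivD derivM derivX derivC mulr1 addr0.
rewrite xey_polyMXaddC xey_polyD xey_polyMX.
rewrite !(derivYD, derivYM, derivYC) {}IHf.
have -> : derivY 'X = 0 :> {poly {poly C}}.
  by rewrite /derivY swapXY_X derivC rmorph0.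
have -> : derivY 'Y = 1 :> {poly {poly C}}.
  by rewrite /derivY swapXY_Y derivX rmorph1.
move: (xey_poly e f) (xey_poly e f^`()) => u v; ring.
Qed.

(** The bivariate polynomial whose coefficients are the real parts of those
of [u]. *)
Definition Re_poly u : {poly {poly R}} := map_poly (map_poly Re) u.

Lemma coef_Re_poly u i j : (Re_poly u)`_i`_j = Re u`_i`_j.
Proof. by rewrite /Re_poly !coef_map_id0 ?map_poly0. Qed.

Lemma Re_polyD u v : Re_poly (u + v) = Re_poly u + Re_poly v.
Proof.
by apply/polyP => i; apply/polyP => j; rewrite !(coefD, coef_Re_poly) ReD.
Qed.

Lemma Re_polyE u x y : (Re_poly u).[x, y] = Re u.[x%:C, y%:C].
Proof.
have Re_hornerE (f : {poly C}) t : (map_poly (Re) f).[t] = Re f.[t%:C].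
  rewrite (horner_coef_wide _ (size_poly _ _)) horner_coef Re_sum.
  by apply: eq_bigr => k _; rewrite coef_map_id0// -rmorphXn ReMr.
have -> : u.[x%:C%:P] = \sum_(k < size u) u`_k * x%:C%:P ^+ k.
  exact: horner_coef.
have -> : (Re_poly u).[x%:P] = \sum_(k < size u) (Re_poly u)`_k * x%:P ^+ k.
  exact: horner_coef_wide (size_poly _ _).
rewrite !horner_sum Re_sum.
apply: eq_bigr => k _; rewrite /Re_poly coef_map_id0 ?map_poly0//.
by rewrite -!polyC_exp !hornerM !hornerC Re_hornerE -rmorphXn ReMr.
Qed.

Lemma deriv_Re_poly u : (Re_poly u)^`() = Re_poly u^`().
Proof.
apply/polyP => i; apply/polyP => j.
by rewrite !(coef_deriv, coefMn, coef_Re_poly) ReMn.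
Qed.

Lemma derivY_Re_poly u : derivY (Re_poly u) = Re_poly (derivY u).
Proof.
apply/polyP => i; apply/polyP => j.
by rewrite !(coef_derivY, coef_deriv, coefMn, coef_Re_poly) ReMn.
Qed.

End RealParts.

Section RealBivariate.
Variable R : rcfType.
Local Notation C := R[i].
Variables (I : Type) (s : seq I) (c : I -> C) (f g : I -> {poly C}).

(** The real bivariate polynomial whose value at [(x, y)] is the real part of
[\sum_k c_k f_k(w) g_k(conj w)], where [w = x + i y]. *)
Definition realified : {poly {poly R}} :=
  Re_poly (\sum_(k <- s)
    (c k)%:P%:P * (xey_poly 'i (f k) * xey_poly (- 'i) (g k))).

Lemma xeyi_polyE (p : {poly C}) (x y : R) :
  (xey_poly 'i p).[x%:C, y%:C] = p.[x +i* y].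
Proof.
rewrite xey_polyE; congr _.[_]; apply/eqP.
by rewrite eq_complex/=; apply/andP; split; apply/eqP; ring.
Qed.

Lemma xeyNi_polyE (p : {poly C}) (x y : R) :
  (xey_poly (- 'i) p).[x%:C, y%:C] = p.[x -i* y].
Proof.
rewrite xey_polyE; congr _.[_]; apply/eqP.
by rewrite eq_complex/=; apply/andP; split; apply/eqP; ring.
Qed.

Let evD (p q : {poly {poly C}}) x y :
  (p + q).[x, y] = p.[x, y] + q.[x, y].
Proof. by rewrite !hornerD. Qed.

Let evM (a : C) (p q : {poly C}) (x y : R) :
  (a%:P%:P * (xey_poly 'i p * xey_poly (- 'i) q)).[x%:C, y%:C] =
  a * (p.[x +i* y] * q.[x -i* y]).
Proof.
rewrite -xeyi_polyE -xeyNi_polyE.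
by move: (xey_poly _ p) (xey_poly _ q) => u v; rewrite !hornerM !hornerC.
Qed.

Lemma realifiedE x y : realified.[x, y] =
  \sum_(k <- s) Re (c k * ((f k).[x +i* y] * (g k).[x -i* y])).
Proof.
rewrite Re_polyE !horner_sum Re_sum; apply: eq_bigr => k _.
by rewrite evM.
Qed.

Let derivX_sum (t : I -> {poly {poly C}}) :
  (\sum_(k <- s) t k)^`() = \sum_(k <- s) (t k)^`().
Proof. exact: (big_morph _ (@derivD _) (deriv0 _)). Qed.

Let derivY_sum (t : I -> {poly {poly C}}) :
  derivY (\sum_(k <- s) t k) = \sum_(k <- s) derivY (t k).
Proof.
apply: (big_morph _ (@derivYD _)).
by have := derivYC (0 : C); rewrite !polyC0.
Qed.

Let derivXM (a : C) (p q : {poly C}) :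
  (a%:P%:P * (xey_poly 'i p * xey_poly (- 'i) q))^`() =
  a%:P%:P * (xey_poly 'i p^`() * xey_poly (- 'i) q) +
  a%:P%:P * (xey_poly 'i p * xey_poly (- 'i) q^`()).
Proof.
rewrite -(deriv_xey_poly 'i p) -(deriv_xey_poly (- 'i) q).
move: (xey_poly _ p) (xey_poly _ q) => u v.
by rewrite derivM derivC mul0r add0r derivM mulrDr.
Qed.

Let derivYM' (a : C) (p q : {poly C}) :
  derivY (a%:P%:P * (xey_poly 'i p * xey_poly (- 'i) q)) =
  (a * 'i)%:P%:P * (xey_poly 'i p^`() * xey_poly (- 'i) q) +
  (- (a * 'i))%:P%:P * (xey_poly 'i p * xey_poly (- 'i) q^`()).
Proof.
have alg (S : comNzRingType) (b j p1 p2 q1 q2 : S) :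
    b * (j * p2 * q1 + p1 * ((- j) * q2)) =
    (b * j) * (p2 * q1) + (- (b * j)) * (p1 * q2) by ring.
rewrite derivYM derivYC mul0r add0r derivYM !derivY_xey_poly.
by rewrite !polyCN !polyCM alg.
Qed.

Let laplM (a : C) (p q : {poly C}) :
  (a%:P%:P * (xey_poly 'i p * xey_poly (- 'i) q))^`()^`() +
  derivY (derivY (a%:P%:P * (xey_poly 'i p * xey_poly (- 'i) q))) =
  (a *+ 4)%:P%:P * (xey_poly 'i p^`() * xey_poly (- 'i) q^`()).
Proof.
have ii (b : C) : b * 'i * 'i = - b.
  case: b => x y; apply/eqP; rewrite eq_complex/=.
  by apply/andP; split; apply/eqP; ring.
have alg (S : comNzRingType) (b p0 p1 p2 q0 q1 q2 : S) :
    b * (p2 * q0) + b * (p1 * q1) + (b * (p1 * q1) + b * (p0 * q2)) +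
    (- b * (p2 * q0) + b * (p1 * q1) +
     (b * (p1 * q1) + - b * (p0 * q2))) = (b *+ 4) * (p1 * q1) by ring.
rewrite derivXM derivYM' derivD derivYD !derivXM !derivYM'.
by rewrite !mulNr !ii !opprK !polyCN !polyCMn alg.
Qed.

Lemma deriv_realifiedE x y : realified^`().[x, y] =
  \sum_(k <- s) Re (c k * ((f k)^`().[x +i* y] * (g k).[x -i* y]) +
                    c k * ((f k).[x +i* y] * (g k)^`().[x -i* y])).
Proof.
rewrite /realified deriv_Re_poly derivX_sum Re_polyE !horner_sum Re_sum.
apply: eq_bigr => k _; by rewrite derivXM evD !evM.
Qed.

Lemma derivY_realifiedE x y : (derivY realified).[x, y] =
  \sum_(k <- s) Re (c k * 'i * ((f k)^`().[x +i* y] * (g k).[x -i* y]) -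
                    c k * 'i * ((f k).[x +i* y] * (g k)^`().[x -i* y])).
Proof.
rewrite /realified derivY_Re_poly derivY_sum Re_polyE !horner_sum Re_sum.
apply: eq_bigr => k _; by rewrite derivYM' evD !evM !mulNr.
Qed.

Lemma laplacian_realifiedE x y :
  (realified^`()^`() + derivY (derivY realified)).[x, y] =
  4 * \sum_(k <- s) Re (c k * ((f k)^`().[x +i* y] * (g k)^`().[x -i* y])).
Proof.
rewrite /realified !deriv_Re_poly !derivY_Re_poly -Re_polyD.
rewrite !derivX_sum !derivY_sum -big_split/= Re_polyE !horner_sum Re_sum.
rewrite mulr_sumr; apply: eq_bigr => k _.
by rewrite laplM evM [RHS]mulr_natl -ReMn mulrnAl.
Qed.

End RealBivariate.

(** * Directional derivatives *)

Section DirectionalDerivatives.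
Variable R : realType.
Local Notation C := R[i].
Implicit Types (u : C -> R) (F : {poly {poly R}}) (x y : R).

Lemma derive_horner2 F x y :
  derivable (fun t => F.[x + t, y]) 0 1 /\
  derive1 (fun t => F.[x + t, y]) 0 = F^`().[x, y].
Proof.
have evE v t : (map_poly (horner_eval y) v).[t] = v.[t, y].
  by have := horner_map (horner_eval y) v t%:P; rewrite /= /horner_eval hornerC.
have -> : (fun t => F.[x + t, y]) =
    horner (map_poly (horner_eval y) F \Po ('X + x%:P)).
  by apply/funext => t; rewrite horner_comp evE !hornerE addrC.
split; first exact: derivable_horner.
rewrite -derivE deriv_comp derivD derivX derivC addr0 mulr1 horner_comp.
by rewrite deriv_map evE !hornerE.
Qed.

Lemma dderive1 u F : (forall x y, u (x +i* y) = F.[x, y]) -> forall x y,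
  dderivable u 1 (x +i* y) /\ dderive u 1 (x +i* y) = F^`().[x, y].
Proof.
move=> uF x y; rewrite /dderivable /dderive.
have -> : (fun t : R => u ((x +i* y) + t%:C *: 1)) = (fun t => F.[x + t, y]).
  apply/funext => t; rewrite -uF; congr u; apply/eqP.
  by rewrite eq_complex/= !mulr1 !mulr0 ?mul0r subr0 !addr0 !eqxx.
exact: derive_horner2.
Qed.

Lemma dderivei u F : (forall x y, u (x +i* y) = F.[x, y]) -> forall x y,
  dderivable u 'i (x +i* y) /\ dderive u 'i (x +i* y) = (derivY F).[x, y].
Proof.
move=> uF x y; rewrite /dderivable /dderive.
have -> : (fun t : R => u ((x +i* y) + t%:C *: 'i)) =
    (fun t => (swapXY F).[y + t, x]).
  apply/funext => t; rewrite horner2_swapXY -uF; congr u; apply/eqP.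
  by rewrite eq_complex/= !mulr1 !mulr0 ?mul0r subr0 !addr0 !eqxx.
by rewrite /derivY horner2_swapXY; exact: derive_horner2.
Qed.

(** The left-hand side is the Laplacian of [harmonic_function]. *)
Lemma dderive_laplacian u F : (forall x y, u (x +i* y) = F.[x, y]) ->
  forall x y, dderive (dderive u 1) 1 (x +i* y) +
    dderive (dderive u 'i) 'i (x +i* y) =
  (F^`()^`() + derivY (derivY F)).[x, y].
Proof.
move=> uF x y; rewrite !hornerD; congr (_ + _).
  by apply: (proj2 (dderive1 _ x y)) => x1 y1; apply: (proj2 (dderive1 uF _ _)).
by apply: (proj2 (dderivei _ x y)) => x1 y1; apply: (proj2 (dderivei uF _ _)).
Qed.

End DirectionalDerivatives.

(** * Means over the unit circle *)

Section CircleMeans.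
Variable R : realType.
Local Notation C := R[i].
Implicit Types (t : R) (a : C).

(** The point [e^(i t)] of the unit circle. *)
Definition cis t : C := cos t +i* sin t.

Lemma cisD t1 t2 : cis (t1 + t2) = cis t1 * cis t2.
Proof. by rewrite /cis cosD sinD [X in _ +i* X]addrC. Qed.

Lemma cis0 : cis 0 = 1.
Proof. by rewrite /cis cos0 sin0. Qed.

Lemma conj_cis t : conjc (cis t) = cis (- t).
Proof. by rewrite /cis cosN sinN. Qed.

Lemma cisMn t n : cis t ^+ n = cis (n%:R * t).
Proof.
elim: n => [|n IHn]; first by rewrite mul0r cis0.
by rewrite exprS IHn -cisD -natr1 mulrDl mul1r addrC.
Qed.

Lemma cis_conjM t j l :
  cis t ^+ j * conjc (cis t) ^+ l = cis ((j%:R - l%:R) * t).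
Proof. by rewrite conj_cis !cisMn -cisD; congr cis; ring. Qed.

Lemma cis2pi : cis (2 * pi) = 1.
Proof. by rewrite /cis mulr_natl cos2pi sin2pi. Qed.

Lemma cis_conjM_2pi j l : cis ((j%:R - l%:R) * (2 * pi)) = 1 :> C.
Proof.
rewrite -cis_conjM cis2pi.
have -> : conjc (1 : C) = 1 by apply/eqP; rewrite eq_complex/= oppr0 !eqxx.
by rewrite !expr1n mul1r.
Qed.

Lemma ReM_cis a t : Re (a * cis t) = Re a * cos t - Im a * sin t.
Proof. by case: a. Qed.

(** The mean over the unit circle of a trigonometric polynomial, by means of a
primitive. *)
Lemma circle_primitive (I : Type) (s : seq I) (c : I -> C) (j l : I -> nat) :
  exists G : R -> R,
    (forall t, is_derive t 1 G
      (\sum_(k <- s) Re (c k * (cis t ^+ j k * conjc (cis t) ^+ l k)))) /\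
    G (2 * pi) - G 0 = 2 * pi * \sum_(k <- s | j k == l k) Re (c k).
Proof.
elim: s => [|k s [G [dG GE]]].
  exists (cst 0); split => [t|]; first by rewrite big_nil; exact: is_derive_cst.
  by rewrite big_nil mulr0 subrr.
pose m : R := (j k)%:R - (l k)%:R.
suff [H [dH HE]] : exists H : R -> R, (forall t, is_derive t 1 H
      (Re (c k * (cis t ^+ j k * conjc (cis t) ^+ l k)))) /\
    H (2 * pi) - H 0 = 2 * pi * (Re (c k) *+ (j k == l k)).
  exists (H \+ G); split => [t|].
    by rewrite big_cons; apply: is_deriveD.
  have -> : (H \+ G) (2 * pi) - (H \+ G) 0 =
      (H (2 * pi) - H 0) + (G (2 * pi) - G 0) by rewrite addrACA -opprD.
  rewrite HE GE big_cons; case: eqP => _.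
    by rewrite mulrb [RHS]mulrDr.
  by rewrite mulrb mulr0 add0r.
case: eqP => [jl|/eqP jl].
  exists (Re (c k) \*: id); split => [t|]; last first.
    rewrite mulrb -[LHS]/(Re (c k) * (2 * pi) - Re (c k) * 0).
    by rewrite mulr0 subr0 mulrC.
  rewrite cis_conjM jl subrr mul0r cis0 mulr1.
  by have := is_deriveZ (Re (c k)) (is_derive_id t (1 : R)); rewrite scaler1.
have m0 : m != 0 by rewrite subr_eq0 eqr_nat.
have dm t : is_derive t 1 (fun x : R => m * x) m.
  have := is_deriveZ m (is_derive_id t (1 : R)).
  by rewrite [X in is_derive _ _ _ X]mulr1.
have ds t : is_derive t 1 (fun x : R => sin (m * x)) (cos (m * t) * m).
  exact: (@is_derive1_comp R sin (fun x => m * x)).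
have dc t : is_derive t 1 (fun x : R => cos (m * x)) (- sin (m * t) * m).
  exact: (@is_derive1_comp R cos (fun x => m * x)).
exists (((Re (c k) / m) \*: (fun x => sin (m * x))) \+
        ((Im (c k) / m) \*: (fun x => cos (m * x)))); split => [t|].
  rewrite cis_conjM ReM_cis -/m.
  have := is_deriveD (is_deriveZ (Re (c k) / m) (ds t))
    (is_deriveZ (Im (c k) / m) (dc t)).
  congr is_derive; rewrite /GRing.scale/=; field.
  exact: m0.
have [c1 s1] : cos (m * (2 * pi)) = 1 /\ sin (m * (2 * pi)) = 0.
  have /(@eqP C) := cis_conjM_2pi (j k) (l k).
  by rewrite eq_complex => /andP[/eqP ? /eqP ?].
rewrite -[LHS]/(
  (Re (c k) / m * sin (m * (2 * pi)) + Im (c k) / m * cos (m * (2 * pi))) -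
  (Re (c k) / m * sin (m * 0) + Im (c k) / m * cos (m * 0))).
by rewrite mulr0 c1 s1 cos0 sin0 subrr mulrb mulr0.
Qed.

Lemma integral_circle (I : Type) (s : seq I) (c : I -> C) (j l : I -> nat) :
  (\int[@lebesgue_measure R]_(t in `[0%R, (2 * pi)%R])
    (\sum_(k <- s) Re (c k * (cis t ^+ j k * conjc (cis t) ^+ l k)))%:E =
  (2 * pi * \sum_(k <- s | j k == l k) Re (c k))%:E)%E.
Proof.
have [G [dG <-]] := circle_primitive s c j l.
have G_cont : continuous G.
  move=> t; apply/differentiable_continuous/derivable1_diffP.
  exact: ex_derive.
rewrite EFinB; apply: continuous_FTC2.
- by rewrite mulr_gt0// pi_gt0.
- apply: continuous_subspaceT => t.
  rewrite (_ : (fun t => _) = (fun t => \sum_(k <- s)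
     (Re (c k) * cos (((j k)%:R - (l k)%:R) * t) -
      Im (c k) * sin (((j k)%:R - (l k)%:R) * t)))); last first.
    by apply/funext => x; apply: eq_bigr => k _; rewrite cis_conjM ReM_cis.
  apply: cvg_big => [|k _]; first exact: add_continuous.
  apply: cvgB; apply: cvgM; try exact: cvg_cst.
    apply: continuous_comp; last exact: continuous_cos.
    by apply: cvgM; [exact: cvg_cst|exact: cvg_id].
  apply: continuous_comp; last exact: continuous_sin.
  by apply: cvgM; [exact: cvg_cst|exact: cvg_id].
- split => [t _| |]; first exact: ex_derive.
  + by apply: cvg_at_right_filter; exact: G_cont.
  + by apply: cvg_at_left_filter; exact: G_cont.
- by move=> t _; rewrite derive1E; exact: derive_val.
Qed.

Lemma circle_mean_ge0 (I : Type) (s : seq I) (c : I -> C) (j l : I -> nat) :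
  (forall t, 0 <=
    \sum_(k <- s) Re (c k * (cis t ^+ j k * conjc (cis t) ^+ l k))) ->
  0 <= \sum_(k <- s | j k == l k) Re (c k).
Proof.
move=> ge0; rewrite -(pmulr_rge0 _ (_ : 0 < 2 * pi :> R)) ?mulr_gt0 ?pi_gt0//.
rewrite -lee_fin -integral_circle; apply: integral_ge0 => t _.
by rewrite lee_fin.
Qed.

End CircleMeans.

(** * Monomials along complex lines *)

Section Monomials.
Variables (K : fieldType) (n : nat).
Implicit Types (e : 'I_n -> nat) (x a b v : 'rV[K]_n) (r : K).

(** The monomial of multi-exponent [e]. *)
Definition monom e x : K := \prod_i x 0 i ^+ e i.

(** The total degree of [monom e]. *)
Definition mdegree e : nat := \sum_i e i.

(** The restriction of a monomial to a complex line: the polynomial in [z]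
whose values are those of the monomial at [a + z b]. *)
Definition line_poly e a b : {poly K} :=
  \prod_i ((a 0 i)%:P + b 0 i *: 'X) ^+ e i.

(** The derivative at [x], in the direction [b], of a monomial: the linear
coefficient of its restriction. *)
Definition monomD e x b : K := (line_poly e x b)`_1.

Lemma horner_line_poly e a b r :
  (line_poly e a b).[r] = monom e (a + r *: b).
Proof.
rewrite /line_poly horner_prod; apply: eq_bigr => i _.
by rewrite horner_exp !hornerE !mxE mulrC.
Qed.

Lemma monomZ e r x : monom e (r *: x) = r ^+ mdegree e * monom e x.
Proof.
rewrite /monom /mdegree expr_sum -big_split/=; apply: eq_bigr => i _.
by rewrite mxE exprMn.
Qed.

Lemma line_polyZ e r a b :
  line_poly e (r *: a) (r *: b) = r ^+ mdegree e *: line_poly e a b.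
Proof.
rewrite -mul_polyC /mdegree expr_sum rmorph_prod -big_split/=.
apply: eq_bigr => i _; rewrite !mxE rmorphXn -exprMn; congr (_ ^+ _).
by rewrite mulrDr polyCM -!mul_polyC polyCM mulrA.
Qed.

Lemma monomDZ e r x b :
  monomD e (r *: x) (r *: b) = r ^+ mdegree e * monomD e x b.
Proof. by rewrite /monomD line_polyZ coefZ. Qed.

Lemma line_poly_mdegree0 e a b : mdegree e = 0%N -> line_poly e a b = 1.
Proof.
move=> /eqP; rewrite sum_nat_eq0 => /forallP e0; apply: big1 => i _.
by have /eqP -> := e0 i; rewrite expr0.
Qed.

Lemma monomD_mdegree0 e x b : mdegree e = 0%N -> monomD e x b = 0.
Proof. by move=> e0; rewrite /monomD line_poly_mdegree0// coef1. Qed.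

Lemma deriv_line_poly e a b r :
  (line_poly e a b)^`().[r] = monomD e (a + r *: b) b.
Proof.
have -> : line_poly e a b = line_poly e (a + r *: b) b \Po ('X - r%:P).
  rewrite /line_poly rmorph_prod; apply: eq_bigr => i _.
  rewrite rmorphXn/= comp_polyD comp_polyC comp_polyZ comp_polyX !mxE.
  rewrite polyCD polyCM -!mul_polyC; congr (_ ^+ _); ring.
rewrite deriv_comp derivXsubC mulr1 horner_comp hornerXsubC subrr.
by rewrite horner_coef0 coef_deriv.
Qed.

(** Linearity in the direction and Euler's identity, for the part [r x] of the
direction. *)
Lemma monomD_euler e x v r :
  monomD e x (r *: x + v) = r * (mdegree e)%:R * monom e x + monomD e x v.
Proof.
rewrite /monomD /line_poly /monom /mdegree.
elim: (index_enum 'I_n) => [|i s IHs].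
  by rewrite !big_nil coef1 mulr0 mul0r addr0.
have coef1M (p q : {poly K}) : (p * q)`_1 = p`_0 * q`_1 + p`_1 * q`_0.
  by rewrite coefM !big_ord_recr big_ord0/= add0r.
have coef0M (p q : {poly K}) : (p * q)`_0 = p`_0 * q`_0.
  by rewrite coefM big_ord_recr big_ord0/= add0r.
have lin0 (a b : K) m : ((a%:P + b *: 'X) ^+ m)`_0 = a ^+ m.
  by rewrite -horner_coef0 horner_exp !hornerE ?mulr0 ?addr0.
have lin1 (a b : K) m : ((a%:P + b *: 'X) ^+ m)`_1 = b * m%:R * a ^+ m.-1.
  elim: m => [|m IHm]; first by rewrite expr0 coef1 mulr0 mul0r.
  rewrite exprS coef1M IHm lin0 !(coefD, coefC, coefZ, coefX)/=.
  case: m {IHm} => [|m]; first by rewrite expr0; ring.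
  by rewrite -[m.+2%:R]natr1 /= exprS; ring.
have prod0 (f : 'I_n -> K) :
    (\prod_(j <- s) ((x 0 j)%:P + f j *: 'X) ^+ e j)`_0 =
    \prod_(j <- s) x 0 j ^+ e j.
  rewrite -horner_coef0 horner_prod; apply: eq_bigr => j _.
  by rewrite horner_exp !hornerE ?mulr0 ?addr0.
rewrite !big_cons !coef1M IHs !prod0 !lin0 !lin1 !mxE natrD.
case: (e i) => [|m]; first by rewrite !expr0; ring.
by rewrite exprS/=; ring.
Qed.

Lemma line_poly0 e x : line_poly e 0 x = monom e x *: 'X^(mdegree e).
Proof.
rewrite /line_poly /monom /mdegree -mul_polyC rmorph_prod expr_sum -big_split/=.
by apply: eq_bigr => i _; rewrite mxE add0r -mul_polyC exprMn rmorphXn.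
Qed.

End Monomials.

(** * Consequences of the sub-mean value inequality *)

Section SubMean.
Variable R : realType.
Local Notation C := R[i].

Lemma coef1_ge0 (p : {poly R}) :
  (forall x : R, x != 0 -> p.[0] <= p.[x ^+ 2]) -> 0 <= p`_1.
Proof.
move=> p_ge0; pose q := \poly_(i < (size p).-1) p`_i.+1.
have pE : p = (p`_0)%:P + 'X * q.
  apply/polyP => -[|i]; rewrite coefD coefC coefXM/= ?addr0// add0r coef_poly.
  by case: ltnP => // pi; rewrite nth_default// (leq_trans (leqSpred _)).
have := @horner_ge0_dense R (q \Po 'X^2) 'X (negbT (polyX_eq0 _)).
move=> /(_ _ 0); rewrite horner_comp hornerXn expr0n/= horner_coef0 coef_poly.
have -> : (if (0 < (size p).-1)%N then p`_1 else 0) = p`_1.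
  by case: ltnP => //; case: (size p) (@nth_default R 0 p 1) => [|[|]]// ->.
apply => x; rewrite hornerX horner_comp hornerXn => x0.
have := p_ge0 x x0; rewrite pE !hornerE lerDl pmulr_rge0//.
by rewrite exprn_even_gt0// x0.
Qed.

Variables (I : finType) (c : I -> C) (f g : I -> {poly C}) (u : C -> R).
Hypothesis uE : forall z,
  u z = \sum_k Re (c k * ((f k).[z] * (g k).[conjc z])).

(** On the circle of center 0 and radius [r], the mean of [u] is a polynomial in
[r^2], whose value at 0 is [u 0] and whose coefficient of [r^2] is the sum in
the conclusion. *)
Lemma subharmonic_coef11_ge0 :
  subharmonic u -> 0 <= \sum_k Re (c k * ((f k)`_1 * (g k)`_1)).
Proof.
move=> [_ submean].
pose N := (\max_k (size (f k) + size (g k))).+2.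
have fN k : (size (f k) <= N)%N.
  apply: leq_trans (leq_trans (leq_addr (size (g k)) _) _)
    (leqW (leqnSn _)) => //.
  exact: (leq_bigmax (F := fun k => (size (f k) + size (g k))%N)).
have gN k : (size (g k) <= N)%N.
  apply: leq_trans (leq_trans (leq_addl (size (f k)) _) _)
    (leqW (leqnSn _)) => //.
  exact: (leq_bigmax (F := fun k => (size (f k) + size (g k))%N)).
pose a i := \sum_k Re (c k * ((f k)`_i * (g k)`_i)).
pose p : {poly R} := \poly_(i < N) a i.
suff : 0 <= p`_1 by rewrite coef_poly.
apply: coef1_ge0 => r r0.
pose J := (I * 'I_N * 'I_N)%type.
pose d (k : J) := c k.1.1 * ((f k.1.1)`_k.1.2 * (g k.1.1)`_k.2) *
  (`|r| ^+ k.1.2 * `|r| ^+ k.2)%:C.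
have uJ t : u (0 + `|r|%:C * cis t) =
    \sum_(k : J) Re (d k * (cis t ^+ k.1.2 * conjc (cis t) ^+ k.2)).
  have conjM : conjc (`|r|%:C * cis t) = `|r|%:C * conjc (cis t).
    rewrite rmorphM/=; congr (_ * _); apply/eqP.
    by rewrite eq_complex/= oppr0 !eqxx.
  rewrite add0r uE; under eq_bigr do rewrite conjM.
  move: (cis t) (conjc (cis t)) {conjM} => z z'.
  rewrite -(pair_bigA _ (fun ki j => Re (d (ki, j) * (z ^+ ki.2 * z' ^+ j))))/=.
  rewrite -(pair_bigA _ (fun k i => \sum_j Re (d ((k, i), j) *
    (z ^+ i * z' ^+ j))))/=.
  apply: eq_bigr => k _.
  rewrite (horner_coef_wide _ (fN k)) (horner_coef_wide _ (gN k)).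
  rewrite mulr_suml mulr_sumr Re_sum; apply: eq_bigr => i _.
  rewrite mulr_sumr mulr_sumr Re_sum; apply: eq_bigr => j _.
  congr Re; rewrite /d/= !exprMn rmorphM !rmorphXn/=; ring.
have := submean 0 `|r| ltac:(by rewrite normr_gt0).
under eq_integral do rewrite -[cos _ +i* sin _]/(cis _) uJ.
rewrite integral_circle lee_fin ler_pM2l ?mulr_gt0 ?pi_gt0//.
have -> : u 0 = p.[0].
  rewrite horner_coef0 coef_poly uE; apply: eq_bigr => k _.
  have -> : conjc (0 : C) = 0 by apply/eqP; rewrite eq_complex/= oppr0 !eqxx.
  by rewrite !horner_coef0.
move=> /le_trans; apply.
rewrite le_eqVlt; apply/orP; left; apply/eqP.
rewrite horner_poly -(pair_big_dep xpredT
  (fun (ki : I * 'I_N) (j : 'I_N) => ki.2 == j :> nat)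
  (fun ki j => Re (d (ki, j))))/=.
rewrite -(pair_bigA _ (fun k (i : 'I_N) =>
  \sum_(j : 'I_N | i == j :> nat) Re (d ((k, i), j))))/=.
rewrite exchange_big/=; apply: eq_bigr => i _; rewrite /a mulr_suml.
apply: eq_bigr => k _; rewrite (big_pred1 i) => [|j]; last first.
  by rewrite /= eq_sym.
rewrite /d/= ReMr -exprMn; congr (_ * _).
by rewrite -expr2 real_normK ?num_real// exprM.
Qed.

End SubMean.

(** * The balanced part of a homogeneous plurisubharmonic polynomial *)

Section DiscriminantInequality.
Variable R : realFieldType.

(** The discriminant inequality for the real quadratic polynomial
[m^2 F |xi|^2 + m Re(xi (X + i Y)) + L] in the complex variable
[xi = p + i q]. *)
Lemma discriminant_le (m F X Y L : R) : 1 <= m ->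
  (forall p q, 0 <= m ^+ 2 * (p ^+ 2 + q ^+ 2) * F + m * (p * X - q * Y) + L) ->
  X ^+ 2 + Y ^+ 2 <= F * (4 * L).
Proof.
move=> m1 ge0; have m0 : 0 < m := lt_le_trans ltr01 m1.
have L0 : 0 <= L.
  have := ge0 0 0.
  by rewrite !expr0n/= !mul0r subrr addr0 mulr0 mul0r mulr0 !add0r.
have [F0|F0|F0] := ltgtP F 0.
- pose p := (L + 1) / (- F) + 1.
  have pF : p * F = - (L + 1) + F by rewrite /p; field; lra.
  have p1 : 1 <= p by rewrite lerDr divr_ge0; lra.
  move: p pF p1 => p pF p1.
  have [] : 0 <= m ^+ 2 * p ^+ 2 * F + L /\ m ^+ 2 * p ^+ 2 * F + L < 0.
    split; first by have := ge0 p 0; have := ge0 (- p) 0; nra.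
    have pF1 : p * (p * F) <= 1 * (p * F) by rewrite ler_wnM2r// pF; lra.
    have mF1 : m ^+ 2 * (p * (p * F)) <= 1 * (p * (p * F)).
      by rewrite ler_wnM2r ?exprn_ege1//; lra.
    by rewrite -mulrA expr2 -(expr2 m) -(mulrA p); lra.
  by lra.
- have := ge0 (- X / (2 * m * F)) (Y / (2 * m * F)).
  have -> : m ^+ 2 * ((- X / (2 * m * F)) ^+ 2 + (Y / (2 * m * F)) ^+ 2) * F +
     m * (- X / (2 * m * F) * X - Y / (2 * m * F) * Y) + L =
     L - (X ^+ 2 + Y ^+ 2) / (4 * F) by field; rewrite !gt_eqF.
  by rewrite subr_ge0 ler_pdivrMr; lra.
- rewrite F0 mul0r leNgt; apply/negP => S0.
  pose S := X ^+ 2 + Y ^+ 2; pose t := (L + 1) / (m * S).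
  have := ge0 (- t * X) (t * Y); rewrite F0.
  have -> : m ^+ 2 * ((- t * X) ^+ 2 + (t * Y) ^+ 2) * 0 +
     m * (- t * X * X - t * Y * Y) + L = L - t * (m * S) by rewrite /S; ring.
  rewrite /t divfK; first lra.
  by rewrite mulf_neq0 ?gt_eqF.
Qed.

End DiscriminantInequality.

Section Family.
Variable R : realType.
Local Notation C := R[i].
Variables (n d : nat) (I : finType) (c : I -> C) (al be : I -> 'I_n -> nat).
Hypothesis degE : forall k, (mdegree (al k) + mdegree (be k) = d)%N.
Variable P : 'rV[C]_n -> R.
Local Notation cj := (map_mx (@conjc R)).
Hypothesis PE : forall z,
  P z = \sum_k Re (c k * (monom (al k) z * monom (be k) (cj z))).

Implicit Types (a b u v x z : 'rV[C]_n) (w : C).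

Lemma map_conjcD a b w : cj (a + w *: b) = cj a + conjc w *: cj b.
Proof. by rewrite map_mxD map_mxZ. Qed.

Lemma line_familyE a b w : P (a + w *: b) =
  \sum_k Re (c k * ((line_poly (al k) a b).[w] *
                    (line_poly (be k) (cj a) (cj b)).[conjc w])).
Proof.
by rewrite PE; apply: eq_bigr => k _; rewrite !horner_line_poly map_conjcD.
Qed.

(** The monomials [z^alpha (conj z)^beta] with [|alpha| = |beta| > 0]. *)
Definition balanced k :=
  (mdegree (al k) == mdegree (be k)) && (0 < mdegree (al k))%N.

(** The balanced part of [P], which is real-valued as only the real parts of
its terms are summed. *)
Definition balanced_part z : R :=
  \sum_(k | balanced k) Re (c k * (monom (al k) z * monom (be k) (cj z))).

Lemma balanced_degree k : balanced k ->
  mdegree (al k) = d./2 /\ mdegree (be k) = d./2.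
Proof.
move=> /andP[/eqP ab _]; have := degE k.
by rewrite ab addnn => <-; rewrite doubleK.
Qed.

(** The Levi form of [P] at [x] in the direction [b]. *)
Definition levi x b : R :=
  \sum_k Re (c k * (monomD (al k) x b * monomD (be k) (cj x) (cj b))).

Section Plurisubharmonic.
Hypothesis Ppsh : plurisubharmonic P.

Lemma levi_ge0 x b : 0 <= levi x b.
Proof.
by apply: (subharmonic_coef11_ge0 (line_familyE x b)); apply: Ppsh.2.
Qed.

(** The mean of [levi (e^(it) x) (e^(it) b)] over [t]. *)
Lemma balanced_levi_ge0 x b :
  0 <= \sum_(k | balanced k)
    Re (c k * (monomD (al k) x b * monomD (be k) (cj x) (cj b))).
Proof.
suff : 0 <= \sum_(k | mdegree (al k) == mdegree (be k))
    Re (c k * (monomD (al k) x b * monomD (be k) (cj x) (cj b))).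
  rewrite (bigID (fun k => (0 < mdegree (al k))%N))/= [X in _ + X]big1 ?addr0//.
  move=> k /andP[_]; rewrite -eqn0Ngt => /eqP k0.
  by rewrite (monomD_mdegree0 _ _ k0) mul0r mulr0.
apply: circle_mean_ge0 => t; have := levi_ge0 (cis t *: x) (cis t *: b).
congr (_ <= _); apply: eq_bigr => k _; congr Re.
rewrite !map_mxZ !monomDZ; set z := conjc _; ring.
Qed.

(** The Levi form of the balanced part at [z] in the direction [xi z + v],
expanded by Euler's identity. *)
Lemma balanced_levi_euler z v p q :
  0 <= (d./2)%:R ^+ 2 * (p ^+ 2 + q ^+ 2) * balanced_part z +
    (d./2)%:R * (p * (\sum_(k | balanced k) Re
        (c k * (monomD (al k) z v * monom (be k) (cj z)) +
         c k * (monom (al k) z * monomD (be k) (cj z) (cj v)))) -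
      q * (\sum_(k | balanced k) Re
        (c k * 'i * (monomD (al k) z v * monom (be k) (cj z)) -
         c k * 'i * (monom (al k) z * monomD (be k) (cj z) (cj v))))) +
    \sum_(k | balanced k) Re
       (c k * (monomD (al k) z v * monomD (be k) (cj z) (cj v))).
Proof.
have := balanced_levi_ge0 z ((p +i* q) *: z + v); congr (_ <= _).
rewrite /balanced_part mulr_sumr -(mulrN q) -sumrN 2!mulr_sumr -big_split/=.
rewrite mulr_sumr -!big_split/=; apply: eq_bigr => k kb.
have [aE bE] := balanced_degree kb.
rewrite (addrC (_ *: z) v) map_conjcD (addrC v) (addrC (cj v)).
rewrite !monomD_euler aE bE.
have -> : (d./2)%:R = ((d./2)%:R : R)%:C :> C by rewrite rmorph_nat.
move: (d./2)%:R (c k) (monom (al k) z) (monom (be k) (cj z)) => m [c1 c2].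
move=> [m1 m2] [n1 n2].
move: (monomD (al k) z v) (monomD (be k) (cj z) (cj v)) => [a1 a2] [b1 b2]/=.
ring.
Qed.

(** The balanced part at [u + (x + i y) v], as a polynomial in [x] and [y]. *)
Definition balanced_line u v : {poly {poly R}} :=
  realified [seq k <- index_enum I | balanced k] c
    (fun k => line_poly (al k) u v) (fun k => line_poly (be k) (cj u) (cj v)).

Lemma balanced_lineE u v (x y : R) :
  (balanced_line u v).[x, y] = balanced_part (u + (x +i* y) *: v).
Proof.
rewrite realifiedE big_filter; apply: eq_bigr => k _.
by rewrite !horner_line_poly map_conjcD.
Qed.

Lemma half_degree_ge1 v : balanced_part v != 0 -> 1 <= (d./2)%:R :> R.
Proof.
move=> v0; rewrite ler1n lt0n; apply: contra_neq v0 => d0.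
rewrite /balanced_part big1// => k kb; have [aE _] := balanced_degree kb.
by move: kb; rewrite /balanced aE d0 andbF.
Qed.

(** The real and imaginary parts of [xi] in [balanced_levi_euler] are free: the
inequality is the discriminant one. *)
Lemma balanced_line_log_laplacian u v (x y : R) : balanced_part v != 0 ->
  0 <= (log_laplacian (balanced_line u v)).[x, y].
Proof.
move=> /half_degree_ge1 m1.
rewrite /log_laplacian !(hornerD, hornerN, horner_exp, hornerM).
rewrite subr_ge0 -!hornerD balanced_lineE /balanced_line.
rewrite laplacian_realifiedE deriv_realifiedE derivY_realifiedE !big_filter.
apply: (discriminant_le m1) => p q.
have := balanced_levi_euler (u + (x +i* y) *: v) v p q; congr (_ <= _).
have conjE : conjc (x +i* y) = x -i* y by [].
congr (_ + _ * (_ * _ - _ * _) + _); apply: eq_bigr => k _;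
  by rewrite !deriv_line_poly ?horner_line_poly map_conjcD conjE.
Qed.

Lemma balanced_partZ w v :
  balanced_part (w *: v) = (Re (w * conjc w)) ^+ d./2 * balanced_part v.
Proof.
rewrite /balanced_part mulr_sumr; apply: eq_bigr => k kb.
have [aE bE] := balanced_degree kb.
have wE : w * conjc w = (Re (w * conjc w))%:C.
  case: w => a b /=; apply/eqP; rewrite eq_complex/= eqxx /=.
  by apply/eqP; ring.
rewrite map_mxZ !monomZ aE bE -ReMl rmorphXn/= -wE exprMn; congr Re; ring.
Qed.

(** If [A] is the balanced part and [A (u + w v) = 0] for all [w], then
[A (v + t u) = 0] for all real [t != 0], by homogeneity, and [A v = 0] by
continuity. *)
Lemma balanced_line_neq0 u v : balanced_part v != 0 -> balanced_line u v != 0.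
Proof.
move=> v0; apply/eqP => F0.
have lineE (w : C) : balanced_part (u + w *: v) = 0.
  by case: w => x y; rewrite -balanced_lineE F0 !horner0.
pose p := map_poly (horner_eval 0) (balanced_line v u).
have pE (t : R) : p.[t] = balanced_part (v + t%:C *: u).
  rewrite -[t%:C]/(t +i* 0) -balanced_lineE.
  have := horner_map (horner_eval 0) (balanced_line v u) t%:P.
  by rewrite /= /horner_eval hornerC.
have p_root (t : R) : t != 0 -> p.[t] = 0.
  move=> t0; have -> : p.[t] = balanced_part (t%:C *: (u + t^-1%:C *: v)).
    rewrite pE scalerDr scalerA -rmorphM divff// rmorph1 scale1r addrC//.
  by rewrite balanced_partZ lineE mulr0.
have p0_ge0 : 0 <= p.[0].
  apply: (horner_ge0_dense (negbT (polyX_eq0 R))) => t; rewrite hornerX.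
  by move=> /p_root ->.
have p0_le0 : 0 <= (- p).[0].
  apply: (horner_ge0_dense (negbT (polyX_eq0 R))) => t; rewrite hornerX.
  by move=> /p_root pt; rewrite hornerN pt oppr0.
have p0 : p.[0] = 0 by rewrite hornerN in p0_le0; lra.
by move: v0; rewrite -p0 pE scale0r addr0 eqxx.
Qed.

(** The zeros of the balanced part on a complex line whose direction [v] is not
one of its zeros. *)
Lemma finite_balanced_zeros u v : balanced_part v != 0 ->
  finite_set [set w : C | balanced_part (u + w *: v) = 0].
Proof.
move=> v0; have fin := finite_set_log_laplacian (balanced_line_neq0 u v0)
  (fun x y : R => balanced_line_log_laplacian u x y v0).
apply: sub_finite_set (finite_image (fun z : R * R => z.1 +i* z.2) fin).
by move=> [x y] /= w0; exists (x, y) => //=; rewrite balanced_lineE.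
Qed.

End Plurisubharmonic.
End Family.

(** * Harmonicity along lines through the origin *)

Section Radial.
Variable R : realType.
Local Notation C := R[i].
Variables (n d : nat) (I : finType) (c : I -> C) (al be : I -> 'I_n -> nat).
Hypothesis degE : forall k, (mdegree (al k) + mdegree (be k) = d)%N.
Local Notation cj := (map_mx (@conjc R)).
Local Notation j k := (mdegree (al k)).
Local Notation l k := (mdegree (be k)).

Implicit Types (x : 'rV[C]_n) (w : C).

(** The coefficients of a quarter of the Laplacian of the polynomial along the
line through the origin and [x]. *)
Definition radial_coef x k : C :=
  c k * (monom (al k) x * monom (be k) (cj x)) * (j k * l k)%:R.

Lemma deriv_line_poly_radial (e : 'I_n -> nat) x w :
  (line_poly e 0 x)^`().[w] = monom e x * (mdegree e)%:R * w ^+ (mdegree e).-1.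
Proof.
by rewrite line_poly0 derivZ derivXn hornerZ hornerMn hornerXn -mulr_natl mulrA.
Qed.

Lemma radial_laplacianE x t :
  \sum_k Re (c k * ((line_poly (al k) 0 x)^`().[cis t] *
                    (line_poly (be k) 0 (cj x))^`().[conjc (cis t)])) =
  \sum_k Re (radial_coef x k * (cis t ^+ (j k).-1 * conjc (cis t) ^+ (l k).-1)).
Proof.
apply: eq_bigr => k _; rewrite !deriv_line_poly_radial /radial_coef natrM.
by congr Re; move: (cis t) (conjc (cis t)) => z z'; ring.
Qed.

Lemma Re_radial_coef x k : Re (radial_coef x k) =
  Re (c k * (monom (al k) x * monom (be k) (cj x))) * (j k * l k)%:R.
Proof. by rewrite -ReMr rmorph_nat. Qed.

(** A term with [|alpha| = 0] or [|beta| = 0] has coefficient 0, so the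
truncated predecessors are harmless. *)
Lemma radial_mean x : \sum_(k | (j k).-1 == (l k).-1) Re (radial_coef x k) =
  (d./2)%:R ^+ 2 * balanced_part c al be x.
Proof.
rewrite [RHS]mulr_sumr big_mkcond [RHS]big_mkcond/=; apply: eq_bigr => k _.
rewrite Re_radial_coef; case: ifPn => kjl; case: ifPn => kb //.
- have [-> ->] := balanced_degree degE kb.
  by rewrite natrM -expr2 mulrC.
- have [j0|j0] := posnP (j k); first by rewrite j0 mul0n mulr0.
  have [l0|l0] := posnP (l k); first by rewrite l0 muln0 mulr0.
  by case/negP: kb; rewrite /balanced j0 andbT -(prednK j0) -(prednK l0) eqSS.
- by case/andP: kb kjl => /eqP ->; rewrite eqxx.
Qed.

Lemma balanced_part_eq0 x :
  (forall t, \sum_k Re (c k * ((line_poly (al k) 0 x)^`().[cis t] *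
      (line_poly (be k) 0 (cj x))^`().[conjc (cis t)])) = 0) ->
  balanced_part c al be x = 0.
Proof.
move=> lap0; have [d0|d0] := posnP d./2.
  rewrite /balanced_part big1// => k kb; have [aE _] := balanced_degree degE kb.
  by move: kb; rewrite /balanced aE d0 andbF.
have mean0 : \sum_(k | (j k).-1 == (l k).-1) Re (radial_coef x k) = 0.
  apply/eqP; rewrite eq_le; apply/andP; split; last first.
    by apply: circle_mean_ge0 => t; rewrite -radial_laplacianE lap0.
  rewrite -oppr_ge0 -sumrN.
  under eq_bigr do rewrite -ReN.
  apply: circle_mean_ge0 => t.
  under eq_bigr do rewrite mulNr ReN.
  by rewrite sumrN -radial_laplacianE lap0 oppr0.
have /eqP := radial_mean x; rewrite mean0 eq_sym mulf_eq0 expf_eq0 pnatr_eq0.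
by rewrite (gtn_eqF d0) => /eqP.
Qed.

Lemma harmonic_balanced_part (P : 'rV[C]_n -> R) x :
  (forall z, P z = \sum_k Re (c k * (monom (al k) z * monom (be k) (cj z)))) ->
  harmonic_function (fun w => P (0 + w *: x)) -> balanced_part c al be x = 0.
Proof.
move=> PE [_ lap0]; apply: balanced_part_eq0 => t.
pose F := realified (index_enum I) c (fun k => line_poly (al k) 0 x)
  (fun k => line_poly (be k) 0 (cj x)).
have PF (x1 y1 : R) : P (0 + (x1 +i* y1) *: x) = F.[x1, y1].
  by rewrite realifiedE (line_familyE PE) map_mx0.
have := lap0 (cis t); rewrite (dderive_laplacian PF) laplacian_realifiedE.
by move=> /eqP; rewrite mulf_eq0 pnatr_eq0/= => /eqP.
Qed.

Section Subharmonic.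
Variable x : 'rV[C]_n.
Hypothesis lap_ge0 : forall t,
  0 <= \sum_k Re (c k * ((line_poly (al k) 0 x)^`().[cis t] *
                         (line_poly (be k) 0 (cj x))^`().[conjc (cis t)])).
Hypothesis x0 : balanced_part c al be x = 0.

(** The Laplacian is nonnegative on the unit circle and its mean is zero:
testing it against [1 + eps cos (s t)], where [eps] is 1 or -1, shows that its
other Fourier coefficients vanish as well. *)
Lemma radial_coef_test (eps : R) s : `|eps| = 1 ->
  0 <= eps * (\sum_(k | ((j k).-1 + s)%N == (l k).-1) Re (radial_coef x k) +
              \sum_(k | (j k).-1 == ((l k).-1 + s)%N) Re (radial_coef x k)).
Proof.
move=> eps1.
pose J := (I + (I + I))%type.
pose D (k : J) : C := match k with inl k => radial_coef x k *+ 2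
  | inr (inl k) => eps%:C * radial_coef x k
  | inr (inr k) => eps%:C * radial_coef x k end.
pose p (k : J) := match k with inl k => (j k).-1
  | inr (inl k) => ((j k).-1 + s)%N | inr (inr k) => (j k).-1 end.
pose q (k : J) := match k with inl k => (l k).-1
  | inr (inl k) => (l k).-1 | inr (inr k) => ((l k).-1 + s)%N end.
have : 0 <= \sum_(k | p k == q k) Re (D k).
  apply: circle_mean_ge0 => t.
  rewrite !big_sumType/= -!big_split/=.
  have : 0 <= 2 * (1 + eps * cos (s%:R * t)) *
      \sum_k Re (radial_coef x k *
        (cis t ^+ (j k).-1 * conjc (cis t) ^+ (l k).-1)).
    rewrite mulr_ge0//; last by rewrite -radial_laplacianE.
    rewrite mulr_ge0// -lerBlDl sub0r.
    have : `|eps * cos (s%:R * t)| <= 1.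
      rewrite normrM eps1 mul1r ler_norml cos_geN1 cos_le1//.
    by rewrite ler_norml => /andP[].
  congr (_ <= _); rewrite mulr_sumr; apply: eq_bigr => k _.
  have ident (A Z W E : C) : 2 * (1 + eps * Re E) * Re (A * (Z * W)) =
      Re (A *+ 2 * (Z * W)) + (Re (eps%:C * A * (Z * E * W)) +
      Re (eps%:C * A * (Z * (W * conjc E)))).
    by rewrite mulr2n; case: A Z W E => [? ?] [? ?] [? ?] [? ?] /=; ring.
  have := ident (radial_coef x k) (cis t ^+ (j k).-1)
    (conjc (cis t) ^+ (l k).-1) (cis t ^+ s).
  rewrite cisMn [conjc (cis (_ * _))]conj_cis -mulrN -(cisMn (- t)) -conj_cis.
  by rewrite -cisMn !exprD cisMn.
rewrite !big_sumType/=.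
under eq_bigr do rewrite ReMn.
rewrite sumrMnl radial_mean x0 mulr0 mul0rn add0r mulrDr !mulr_sumr.
by congr (_ <= _ + _); apply: eq_bigr => k _; rewrite ReMl.
Qed.

Lemma radial_coef_cancel s :
  \sum_(k | ((j k).-1 + s)%N == (l k).-1) Re (radial_coef x k) +
  \sum_(k | (j k).-1 == ((l k).-1 + s)%N) Re (radial_coef x k) = 0.
Proof.
have := @radial_coef_test 1 s ltac:(by rewrite normr1).
have := @radial_coef_test (-1) s ltac:(by rewrite normrN1).
by rewrite mul1r mulN1r => ? ?; lra.
Qed.

(** For a fixed distance [s] between [|alpha|] and [|beta|], whose sum is [d],
the product [|alpha| |beta|] is a constant, which can be divided out of
[radial_coef_cancel]. *)
Lemma mixed_sum_eq0 : \sum_(k | (0 < j k)%N && (0 < l k)%N)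
  Re (c k * (monom (al k) x * monom (be k) (cj x))) = 0.
Proof.
pose dist k := (j k - l k + (l k - j k))%N.
have dist_le k : (dist k < d.+1)%N by rewrite /dist -(degE k); lia.
rewrite (partition_big (fun k => inord (dist k) : 'I_d.+1) xpredT)//=.
apply: big1 => s _.
under eq_bigl => k do rewrite -val_eqE/= inordK//.
case: s => s /= _.
have [s0|s0] := posnP s.
  rewrite -[RHS]x0; apply: eq_bigl => k; rewrite /balanced /dist s0.
  by apply/idP/idP; lia.
have := radial_coef_cancel s.
rewrite big_mkcond [X in _ + X]big_mkcond -big_split/=.
pose w := ((d ^ 2 - s ^ 2) %/ 4)%N.
have prodE k : dist k = s -> (j k * l k)%N = w.
  rewrite /w /dist -(degE k) => <-.
  have -> : ((j k + l k) ^ 2 - (j k - l k + (l k - j k)) ^ 2 = j k * l k * 4)%N.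
    by have [jl|/ltnW jl] := leqP (j k) (l k); move: jl; nia.
  by rewrite mulnK.
under eq_bigr => k _.
  rewrite (_ : _ + _ = if [&& (0 < j k)%N && (0 < l k)%N & dist k == s]
    then Re (c k * (monom (al k) x * monom (be k) (cj x))) * w%:R
    else 0); last first.
    rewrite Re_radial_coef; have [j0|j0] := posnP (j k).
      by rewrite j0 mul0n mulr0 !if_same addr0.
    have [l0|l0] := posnP (l k); first by rewrite l0 muln0 mulr0 !if_same addr0.
    have [ks|/eqP ks] := eqVneq (dist k) s => /=.
      rewrite (prodE k ks); case: eqP => e1; case: eqP => e2;
        rewrite ?addr0 ?add0r//.
        by move: e1 e2; lia.
      by move: ks e1 e2; rewrite /dist; lia.
    case: eqP => e1; first by move: ks; rewrite /dist; lia.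
    by case: eqP => e2; rewrite ?addr0//; move: ks; rewrite /dist; lia.
  over.
rewrite -big_mkcond -mulr_suml => /eqP; rewrite mulf_eq0 => /orP[/eqP//|].
rewrite pnatr_eq0 => /eqP w0; apply: big1 => k /andP[/andP[jk lk] /eqP ks].
by have := prodE k ks; rewrite w0; nia.
Qed.

End Subharmonic.
End Radial.

(** * Regularity of real polynomials *)

Section RealPolynomials.
Variable R : realType.
Local Notation C := R[i].

(** Real polynomial functions: the algebra generated by the constants and the
continuous real-linear forms. *)
Inductive real_polynomial (V : normedModType C) : (V -> R) -> Prop :=
| real_polynomial_cst r : real_polynomial (fun _ => r)
| real_polynomial_lin l :
    (forall (x v : V) (t : R), l (x + t%:C *: v) = l x + t * l v) ->
    continuous l -> real_polynomial l
| real_polynomialD f g : real_polynomial f -> real_polynomial g ->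
    real_polynomial (fun x => f x + g x)
| real_polynomialM f g : real_polynomial f -> real_polynomial g ->
    real_polynomial (fun x => f x * g x).

Section OnSpace.
Variable V : normedModType C.
Implicit Types (f g : V -> R) (A : set V).

Lemma real_polynomial_continuous f : real_polynomial f -> continuous f.
Proof.
elim=> {f} [r|l _ //|f g _ cf _ cg|f g _ cf _ cg] x; first exact: cvg_cst.
- by apply: cvgD; [exact: cf|exact: cg].
- by apply: cvgM; [exact: cf|exact: cg].
Qed.

Lemma real_polynomial_is_derive f (v : V) : real_polynomial f ->
  exists2 df, real_polynomial df &
    forall x, is_derive (0 : R) 1 (fun t : R => f (x + t%:C *: v)) (df x).
Proof.
elim=> {f} [r|l lin cl|f g fp [df dfp fE] gp [dg dgp gE]|
  f g fp [df dfp fE] gp [dg dgp gE]].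
- exists (fun _ => 0); first exact: real_polynomial_cst.
  by move=> x; exact: is_derive_cst.
- exists (fun _ => l v); first exact: real_polynomial_cst.
  move=> x; have -> : (fun t : R => l (x + t%:C *: v)) =
      (fun t : R => cst (l x) t + (l v \*: id) t).
    by apply/funext => t; rewrite lin mulrC.
  have := is_deriveD (is_derive_cst (l x) (0 : R) (1 : R))
    (is_deriveZ (l v) (is_derive_id (0 : R) (1 : R))).
  by rewrite add0r [X in is_derive _ _ _ X]mulr1.
- exists (fun x => df x + dg x); first exact: real_polynomialD.
  by move=> x; exact: is_deriveD.
- exists (fun x => f x * dg x + g x * df x).
    by apply: real_polynomialD; exact: real_polynomialM.
  move=> x; have := is_deriveM (fE x) (gE x).
  by rewrite /= !scale0r !addr0.
Qed.

Lemma real_polynomial_dderive f (v : V) : real_polynomial f ->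
  (forall x, dderivable f v x) /\ real_polynomial (dderive f v).
Proof.
move=> /(@real_polynomial_is_derive f v)[df dfp dfE]; split=> [x|].
  by case: (dfE x).
suff -> : dderive f v = df by [].
by apply/funext => x; rewrite /dderive derive1E; exact: derive_val.
Qed.

Lemma real_polynomial_C2 A f : real_polynomial f -> C2_along A f.
Proof.
move=> fp v w _ _; have [dv vp] := real_polynomial_dderive v fp.
have [dw wp] := real_polynomial_dderive w vp.
split=> [x _|]; first by split.
by apply: continuous_subspaceT; exact: real_polynomial_continuous.
Qed.

(** Complex polynomial functions, through their real and imaginary parts. *)
Definition complex_polynomial (f : V -> C) : Prop :=
  real_polynomial (fun x => Re (f x)) /\ real_polynomial (fun x => Im (f x)).

Lemma real_polynomialN f :
  real_polynomial f -> real_polynomial (fun x => - f x).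
Proof.
move=> fp; have := real_polynomialM (real_polynomial_cst V (-1)) fp.
by congr real_polynomial; apply/funext => x; rewrite mulN1r.
Qed.

Lemma real_polynomial_sum (I : Type) (s : seq I) (f : I -> V -> R) :
  (forall k, real_polynomial (f k)) ->
  real_polynomial (fun x => \sum_(k <- s) f k x).
Proof.
move=> fp; elim: s => [|k s IHs].
  have := real_polynomial_cst V 0.
  by congr real_polynomial; apply/funext => x; rewrite big_nil.
have := real_polynomialD (fp k) IHs.
by congr real_polynomial; apply/funext => x; rewrite big_cons.
Qed.

Lemma complex_polynomial_cst (a : C) : complex_polynomial (fun _ => a).
Proof. by split; exact: real_polynomial_cst. Qed.

Lemma complex_polynomialD (f g : V -> C) : complex_polynomial f ->
  complex_polynomial g -> complex_polynomial (fun x => f x + g x).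
Proof.
move=> [f1 f2] [g1 g2]; split.
  have := real_polynomialD f1 g1; congr real_polynomial.
  by apply/funext => x; case: (f x) (g x) => ? ? [].
have := real_polynomialD f2 g2; congr real_polynomial.
by apply/funext => x; case: (f x) (g x) => ? ? [].
Qed.

Lemma complex_polynomialM (f g : V -> C) : complex_polynomial f ->
  complex_polynomial g -> complex_polynomial (fun x => f x * g x).
Proof.
move=> [f1 f2] [g1 g2]; split.
  have := real_polynomialD (real_polynomialM f1 g1)
    (real_polynomialN (real_polynomialM f2 g2)).
  by congr real_polynomial; apply/funext => x; case: (f x) (g x) => ? ? [].
have := real_polynomialD (real_polynomialM f1 g2) (real_polynomialM f2 g1).
by congr real_polynomial; apply/funext => x; case: (f x) (g x) => ? ? [].
Qed.

Lemma complex_polynomial_conj (f : V -> C) : complex_polynomial f ->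
  complex_polynomial (fun x => conjc (f x)).
Proof.
move=> [f1 f2]; split.
  by move: f1; congr real_polynomial; apply/funext => x; case: (f x).
have := real_polynomialN f2.
by congr real_polynomial; apply/funext => x; case: (f x).
Qed.

Lemma complex_polynomial_monom n (e : 'I_n -> nat) (h : V -> 'rV[C]_n) :
  (forall i, complex_polynomial (fun x => h x 0 i)) ->
  complex_polynomial (fun x => monom e (h x)).
Proof.
move=> hp; rewrite /monom; elim: (index_enum 'I_n) => [|i s IHs].
  have := complex_polynomial_cst 1.
  by congr complex_polynomial; apply/funext => x; rewrite big_nil.
have powp : complex_polynomial (fun x => h x 0 i ^+ e i).
  elim: (e i) => [|m IHm]; first exact: complex_polynomial_cst.
  have := complex_polynomialM (hp i) IHm.
  by congr complex_polynomial; apply/funext => x; rewrite exprS.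
have := complex_polynomialM powp IHs.
by congr complex_polynomial; apply/funext => x; rewrite big_cons.
Qed.

Lemma real_polynomial_family n (I : finType) (c : I -> C)
    (al be : I -> 'I_n -> nat) (h : V -> 'rV[C]_n) :
  (forall i, complex_polynomial (fun x => h x 0 i)) ->
  real_polynomial (fun x => \sum_k
    Re (c k * (monom (al k) (h x) * monom (be k) (map_mx (@conjc R) (h x))))).
Proof.
move=> hp; apply: real_polynomial_sum => k.
apply: (complex_polynomialM (complex_polynomial_cst (c k)) _).1.
apply: complex_polynomialM; apply: complex_polynomial_monom => // i.
have := complex_polynomial_conj (hp i).
by congr complex_polynomial; apply/funext => x; rewrite mxE.
Qed.

End OnSpace.

Lemma lipschitz1_continuous (V : normedModType C) (l : V -> R) :
  (forall x y, `|l x - l y|%:C <= `|x - y|) -> continuous l.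
Proof.
move=> l_lip x; apply/cvgrPdist_lt => e e0.
have eC : 0 < e%:C by rewrite ltcR.
near=> y; rewrite -ltcR; apply: le_lt_trans (l_lip x y) _.
near: y; exact: cvgr_dist_lt.
Unshelve. all: end_near. Qed.

Lemma normc_ge_Im (z : C) : `|Im z|%:C <= `|z|.
Proof.
rewrite normc_def lecR -sqrtr_sqr ler_wsqrtr//.
by rewrite -[X in X <= _]add0r lerD2r sqr_ge0.
Qed.

Lemma complex_polynomial_id : complex_polynomial (fun z : C => z).
Proof.
split; apply: real_polynomial_lin.
- move=> [x1 x2] [v1 v2] t /=.
  by rewrite mul0r subr0.
- apply: lipschitz1_continuous => x y.
  by have := normc_ge_Re (x - y); congr (_%:C <= _); case: x y => [? ?] [? ?].
- move=> [x1 x2] [v1 v2] t /=.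
  by rewrite mul0r addr0.
- apply: lipschitz1_continuous => x y.
  by have := normc_ge_Im (x - y); congr (_%:C <= _); case: x y => [? ?] [? ?].
Qed.

Lemma complex_polynomial_coord n (i : 'I_n) :
  complex_polynomial (fun z : 'rV[C]_n => z 0 i).
Proof.
have lin (x v : 'rV[C]_n) (t : R) :
    (x + t%:C *: v) 0 i = x 0 i + t%:C * v 0 i by rewrite !mxE.
have cont (f : C -> R) :
    continuous f -> continuous (fun z : 'rV[C]_n => f (z 0 i)).
  by move=> cf z; apply: continuous_comp; [exact: coord_continuous|exact: cf].
split; apply: real_polynomial_lin.
- move=> x v t; rewrite lin; case: (x 0 i) (v 0 i) => [? ?] [? ?] /=.
  by rewrite mul0r subr0.
- apply: cont; apply: lipschitz1_continuous => x y.
  by have := normc_ge_Re (x - y); congr (_%:C <= _); case: x y => [? ?] [? ?].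
- move=> x v t; rewrite lin; case: (x 0 i) (v 0 i) => [? ?] [? ?] /=.
  by rewrite mul0r addr0.
- apply: cont; apply: lipschitz1_continuous => x y.
  by have := normc_ge_Im (x - y); congr (_%:C <= _); case: x y => [? ?] [? ?].
Qed.

End RealPolynomials.

(** * Hyperplanes *)

Section Hyperplanes.
Variables (K : fieldType) (n : nat).
Implicit Types (H : {vspace 'rV[K]_n}) (v : 'rV[K]_n).

Lemma hyperplane_addv_line H v :
  \dim H = (n - 1)%N -> v \notin H -> (H + <[v]>)%VS = fullv.
Proof.
move=> dimH vH; apply/eqP; rewrite eqEdim subvf dimvf dim_matrix mul1r/=.
have : (\dim H < \dim (H + <[v]>))%N.
  rewrite ltn_neqAle dimvS ?addvSl// andbT (dimv_leqif_eq (addvSl _ _)).2.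
  apply: contra vH => /eqP ->; apply: (subvP (addvSr _ _)); exact: memv_line.
by rewrite dimH; lia.
Qed.

(** A hyperplane [H] that does not contain [v] is spanned by its points on the
lines parallel to [v] through the unit vectors. *)
Lemma hyperplane_span H v : \dim H = (n - 1)%N -> v \notin H ->
  exists2 w : 'I_n -> K, forall i, delta_mx 0 i + w i *: v \in H &
    H = <<[seq (delta_mx 0 i + w i *: v)%R | i <- enum 'I_n]>>%VS.
Proof.
move=> dimH vH; have Hv := hyperplane_addv_line dimH vH.
have /choice[w wP] (i : 'I_n) : exists w, delta_mx 0 i + w *: v \in H.
  have : delta_mx 0 i \in (H + <[v]>)%VS by rewrite Hv memvf.
  move=> /memv_addP[h hH [_ /vlineP[k ->] ->]].
  by exists (- k); rewrite scaleNr addrK.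
exists w => //; set U := <<_>>%VS.
have UH : (U <= H)%VS.
  by apply/span_subvP => _ /mapP[i _ ->].
have vU : v \notin U by apply: contra vH => /(subvP UH).
have Uv : (U + <[v]>)%VS = fullv.
  apply/eqP; rewrite eqEsubv subvf/=; apply/subvP => x _.
  rewrite (row_sum_delta x); apply: memv_suml => i _; apply: memvZ.
  rewrite -[delta_mx 0 i](addrK (w i *: v)) memv_add//.
    by apply: memv_span; apply/mapP; exists i => //; rewrite mem_enum.
  by rewrite -scaleNr memvZ// memv_line.
apply/esym/eqP; rewrite eqEdim UH/= dimH.
have := dimv_sum_cap U <[v]>; rewrite Uv dimvf dim_matrix mul1r dim_vline.
by case: (v != 0) => /=; move: (\dim (U :&: _)) (\dim U) => p q; lia.
Qed.

(** Hyperplanes that meet each of these lines in a given finite set of points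
are finitely many. *)
Lemma finite_hyperplanes (F : 'I_n -> set K) v (A : set {vspace 'rV[K]_n}) :
  (forall i, finite_set (F i)) ->
  (forall H, A H -> \dim H = (n - 1)%N /\ v \notin H /\
    forall i w, delta_mx 0 i + w *: v \in H -> F i w) ->
  finite_set A.
Proof.
move=> finF AP.
have : finite_set (\bigcup_(i in [set: 'I_n]) F i) by exact: bigcup_finite.
move=> /finite_seqP[s sE].
pose S (f : {ffun 'I_n -> 'I_(size s)}) : {vspace 'rV[K]_n} :=
  <<[seq (delta_mx 0 i + s`_(f i) *: v)%R | i <- enum 'I_n]>>%VS.
apply: (sub_finite_set (B := S @` setT)); last exact: finite_image.
move=> H /AP[dimH [vH HF]]; have [w wH HE] := hyperplane_span dimH vH.
have ws i : w i \in s.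
  have : (\bigcup_(i in [set: 'I_n]) F i) (w i) by exists i => //; exact: HF.
  by rewrite sE.
have ilt i : (index (w i) s < size s)%N by rewrite index_mem.
exists [ffun i => Ordinal (ilt i)] => //; rewrite HE /S.
by congr span; apply: eq_map => i; rewrite ffunE/= nth_index.
Qed.

End Hyperplanes.

(** * Homogeneous polynomials *)

Section HomogeneousPolynomials.
Variable R : realType.
Local Notation C := R[i].
Variables (n : nat) (P : 'rV[C]_n -> R).
Local Notation cj := (map_mx (@conjc R)).

(** The exponents [al k] and [be k] are those of [z] and of its conjugate in the
[k]-th monomial. *)
Lemma homogeneous_polynomial_family : homogeneous_polynomial P ->
  exists (d : nat) (I : finType) (c : I -> C) (al be : I -> 'I_n -> nat),
    (forall k, mdegree (al k) + mdegree (be k) = d)%N /\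
    forall z, P z = \sum_k Re (c k * (monom (al k) z * monom (be k) (cj z))).
Proof.
move=> [d [p [p_hom PE]]].
pose t := in_tuple (mpoly.msupp p).
exists d, 'I_(size (mpoly.msupp p)), (fun k => mpoly.mcoeff (tnth t k) p),
  (fun k i => mpoly.fun_of_multinom (tnth t k) (lshift n i)),
  (fun k i => mpoly.fun_of_multinom (tnth t k) (rshift n i)).
split=> [k|z].
  by rewrite -(p_hom (tnth t k)) ?mem_tnth// mpoly.mdegE big_split_ord.
rewrite -[LHS]/(Re (P z)%:C) PE mpoly.mevalE big_tnth Re_sum.
apply: eq_bigr => k _; congr (Re (_ * _)); rewrite big_split_ord.
congr (_ * _); apply: eq_bigr => i _.
  by rewrite row_mxEl.
by rewrite row_mxEr.
Qed.

Variables (d : nat) (I : finType) (c : I -> C) (al be : I -> 'I_n -> nat).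
Hypothesis degE : forall k, (mdegree (al k) + mdegree (be k) = d)%N.
Hypothesis PE : forall z,
  P z = \sum_k Re (c k * (monom (al k) z * monom (be k) (cj z))).

(** Only the terms that are holomorphic or antiholomorphic remain. *)
Lemma balanced_part_eq0_pluriharmonic : plurisubharmonic P ->
  (forall z, balanced_part c al be z = 0) -> pluriharmonic P.
Proof.
move=> Ppsh A0.
pose pure k := ~~ ((0 < mdegree (al k))%N && (0 < mdegree (be k))%N).
have Ppure z :
    P z = \sum_(k | pure k) Re (c k * (monom (al k) z * monom (be k) (cj z))).
  rewrite PE (bigID pure)/= [X in _ + X]big_mkcond/=.
  rewrite [X in _ + X](_ : _ = 0) ?addr0// -big_mkcond/=.
  under eq_bigl do rewrite negbK.
  apply: (mixed_sum_eq0 degE) => [t|]; last exact: A0.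
  have := levi_ge0 PE Ppsh (cis t *: z) z.
  congr (_ <= _); apply: eq_bigr => k _.
  by rewrite !deriv_line_poly !add0r map_mxZ.
split.
  apply: real_polynomial_C2.
  have := real_polynomial_family c al be (@complex_polynomial_coord R n).
  by congr real_polynomial; apply/funext => z; rewrite PE.
move=> a b _ _; split.
  apply: real_polynomial_C2.
  have := @real_polynomial_family R _ n I c al be (fun z : C => a + z *: b) _.
  have -> : (fun z => P (a + z *: b)) = (fun z => \sum_k
      Re (c k * (monom (al k) (a + z *: b) * monom (be k) (cj (a + z *: b))))).
    by apply/funext => z; rewrite PE.
  apply=> i.
  have := complex_polynomialD (complex_polynomial_cst C (a 0 i))
    (complex_polynomialM (complex_polynomial_id R)
      (complex_polynomial_cst C (b 0 i))).
  by congr complex_polynomial; apply/funext => z; rewrite !mxE.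
pose F := realified [seq k <- index_enum I | pure k] c
  (fun k => line_poly (al k) a b) (fun k => line_poly (be k) (cj a) (cj b)).
have PF (x y : R) : P (a + (x +i* y) *: b) = F.[x, y].
  rewrite realifiedE big_filter Ppure; apply: eq_bigr => k _.
  by rewrite !horner_line_poly map_conjcD.
move=> [x y]; rewrite (dderive_laplacian PF) laplacian_realifiedE big_filter.
rewrite big1 ?mulr0// => k; rewrite /pure negb_and -!eqn0Ngt => /orP[] /eqP k0.
  by rewrite (line_poly_mdegree0 _ _ k0) -polyC1 derivC horner0 mul0r mulr0.
rewrite [X in (_ * X^`().[_])](line_poly_mdegree0 _ _ k0) -polyC1 derivC.
by rewrite horner0 !mulr0.
Qed.

End HomogeneousPolynomials.

Theorem proposition2p1 (R : realType) (n : nat) (hn : (2 <= n)%N)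
    (P : 'rV[R[i]]_n -> R)
    (P_hom : homogeneous_polynomial P)
    (P_psh : plurisubharmonic P)
    (P_nph : ~ pluriharmonic P) :
  finite_set [set H : {vspace 'rV[R[i]]_n} |
    \dim H = (n - 1)%N /\ pluriharmonic_along H P].
Proof.
have [d [I [c [al [be [degE PE]]]]]] := homogeneous_polynomial_family P_hom.
have [v v0] : exists v, balanced_part c al be v != 0.
  apply: contrapT => nov; apply: P_nph.
  apply: (balanced_part_eq0_pluriharmonic degE PE) => // z.
  by apply/eqP/negPn/negP => z0; apply: nov; exists z.
have vanish (H : {vspace 'rV[R[i]]_n}) x :
    pluriharmonic_along H P -> x \in H -> balanced_part c al be x = 0.
  move=> [_ harmH] xH; apply: (harmonic_balanced_part degE PE).
  by apply: harmH => //; exact: mem0v.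
apply: (finite_hyperplanes (v := v) (F := fun i =>
  [set w | balanced_part c al be (delta_mx 0 i + w *: v) = 0])).
  by move=> i; exact: (finite_balanced_zeros degE PE).
move=> H [dimH harmH]; split=> //; split=> [|i w].
  by apply: contra_neqN v0 => /(vanish H v harmH).
exact: vanish.
Qed.
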